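(* Let $n\ge 2$ and let $E$ be a closed set in $\overline{\mathbb{R}}^n$ containing at least two points. Then $E$ is uniformly perfect if and only if there exists a constant $M>0$ such that every ring $\mathcal{R}$ in $\overline{\mathbb{R}}^n$ which separates $E$ satisfies $\operatorname{mod}\mathcal{R}\le M$.
   Context: $\overline{\mathbb{R}}^n=\mathbb{R}^n\cup\{\infty\}$. A closed subset $E$ of $\overline{\mathbb{R}}^n$ with at least two points is uniformly perfect if there is a constant $0<c<1$ such that $$\{x\in E: cr<|x-a|<r\}\ne\varnothing\quad\text{for all } a\in E\setminus\{\infty\},\ 0<r<\operatorname{diam}E,$$ where $\operatorname{diam}E$ is the Euclidean diameter, with $\operatorname{diam}E=\infty$ when $\infty\in E$. For a family $\Gamma$ of curves in $\overline{\mathbb{R}}^n$, a Borel function $\rho\ge 0$ on $\mathbb{R}^n$ is admissible if $\int_\gamma\rho\,|dx|\ge 1$ for every locally rectifiable $\gamma\in\Gamma$; $\mathsf{M}(\Gamma)=\inf_\rho\int_{\mathbb{R}^n}\rho^n\,dm$ over admissible $\rho$. A continuum is a nonempty connected compact set; a continuum $C\subsetneq\overline{\mathbb{R}}^n$ is filled if $\overline{\mathbb{R}}^n\setminus C$ is connected. For disjoint filled continua $C_0,C_1$ the domain $\mathcal{R}=\overline{\mathbb{R}}^n\setminus(C_0\cup C_1)$ is called a ring. It separates $E$ if $\mathcal{R}\cap E=\varnothing$ and $C_j\cap E\neq\varnothing$ for $j=0,1$. Its modulus is $\operatorname{mod}\mathcal{R}=[\omega_{n-1}/\mathsf{M}(\Gamma_{\mathcal{R}})]^{1/(n-1)}\in(0,\infty]$,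 where $\Gamma_{\mathcal{R}}$ is the family of all curves joining $C_0$ and $C_1$ in $\mathcal{R}$ and $\omega_{n-1}$ is the area of the unit sphere in $\mathbb{R}^n$ (the modulus is $\infty$ when $\mathsf{M}(\Gamma_{\mathcal R})=0$). *)

(* Defs.v *)
From HB Require Import structures.
From mathcomp Require Import all_boot all_order all_algebra.
From mathcomp Require Import all_classical all_reals all_analysis.
From mathcomp Require Import measurable_realfun.
Set Implicit Arguments.
Unset Strict Implicit.
Unset Printing Implicit Defensive.
Import Order.TTheory GRing.Theory Num.Theory.
Import numFieldNormedType.Exports.
Local Open Scope classical_set_scope.
Local Open Scope ring_scope.

(* The library norm on ['rV[R]_n] is the sup norm, which induces the same
   topology as the Euclidean norm. *)
Definition enorm (R : realType) (n : nat) (x : 'rV[R]_n) : R :=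
  Num.sqrt (\sum_(i < n) x ord0 i ^+ 2).

(* [Some x] is a finite point, [None] is the point at infinity. *)
Notation rVbar R n := (one_point_compactification 'rV[R]_n).

Notation borel_rV R n := (g_sigma_algebraType (@open 'rV[R]_n)).

Section LebesgueMeasure.
Context {R : realType}.

Lemma measurable_borel_coord n (i : 'I_n) :
  measurable_fun [set: borel_rV R n]
    ((fun x : 'rV[R]_n => x ord0 i) : borel_rV R n -> R).
Proof.
apply: (measurability _ (measurable_realfun.RGenOpens.measurableE R)).
move=> _ [_ [a [b ->]] <-]; rewrite setTI; apply: sub_sigma_algebra.
by apply: open_comp; [move=> x _; exact: coord_continuous|exact: interval_open].
Qed.

Lemma measurable_fun_borel_rV d (T : measurableType d) n
    (f : T -> borel_rV R n) :
  (forall i, measurable_fun setT (fun t => (f t : 'rV[R]_n) ord0 i)) ->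
  measurable_fun setT f.
Proof.
move=> mf; apply: (@measurability _ _ T (borel_rV R n) setT f (@open 'rV[R]_n)) => //.
move=> _ [U oU <-].
pose box (q : 'rV[rat * rat]_n) := [set x : 'rV[R]_n |
  forall i, x ord0 i \in `]ratr (q ord0 i).1, ratr (q ord0 i).2[].
pose F q := [set t | box q `<=` U /\ box q (f t)].
have -> : setT `&` f @^-1` U = \bigcup_q F q.
  rewrite setTI eqEsubset; split=> [t Ut|t [q _]]; last first.
    by move=> [qU /qU].
  have /nbhs_ballP[e /= e0 eU] : nbhs (f t : 'rV[R]_n) U.
    by apply: open_nbhs_nbhs; split.
  have /choice[q1 Hq1] i : exists q : rat,
      (ratr q : R) \in `](f t : 'rV[R]_n) ord0 i - e, (f t : 'rV[R]_n) ord0 i[.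
    by apply: rat_in_itvoo; rewrite ltrBlDr ltrDl.
  have /choice[q2 Hq2] i : exists q : rat,
      (ratr q : R) \in `](f t : 'rV[R]_n) ord0 i, (f t : 'rV[R]_n) ord0 i + e[.
    by apply: rat_in_itvoo; rewrite ltrDl.
  exists (\row_i (q1 i, q2 i)) => //; split; last first.
    move=> i.
    rewrite mxE /= in_itv/=.
    by move: (Hq1 i) (Hq2 i); rewrite !in_itv/= => /andP[_ ->] /andP[-> _].
  move=> x xq; apply: eU; split => // i j; rewrite ord1.
  move: (xq j) (Hq1 j) (Hq2 j); rewrite mxE/= !in_itv/=.
  move=> /andP[x1 x2] /andP[y1 y2] /andP[z1 z2].
  rewrite /ball/= distrC ltr_distl (lt_trans y1 x1) /=.
  exact: lt_trans x2 z2.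
apply: countable_bigcupT_measurable => [|q]; first exact: countableP.
have [qU|qU] := pselect (box q `<=` U); last first.
  by rewrite (_ : F q = set0); [exact: measurable0|rewrite -subset0 => t []].
have -> : F q = \bigcap_(i in [set: 'I_n])
    (fun t => (f t : 'rV[R]_n) ord0 i) @^-1`
      `]ratr (q ord0 i).1, ratr (q ord0 i).2[%classic.
  apply/seteqP; split=> [t [_ tq] i _|t tq]; first exact: tq.
  by split=> // i; exact: (tq i I).
apply: fin_bigcap_measurable; first exact: finite_finset.
by move=> i _; rewrite -[X in measurable X]setTI; apply: mf.
Qed.

Definition cons_rV n (p : measurableTypeR R * borel_rV R n) :
    borel_rV R n.+1 :=
  row_mx ((p.1 : R)%:M : 'rV_1) (p.2 : 'rV_n).

Lemma cons_rV0 n (p : measurableTypeR R * borel_rV R n) :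
  (cons_rV p : 'rV[R]_n.+1) ord0 ord0 = p.1.
Proof.
rewrite (_ : ord0 = lshift n (ord0 : 'I_1)); last exact: val_inj.
by apply: etrans (row_mxEl _ _ _ _) _; rewrite mxE eqxx mulr1n.
Qed.

Lemma cons_rVS n (p : measurableTypeR R * borel_rV R n) (i : 'I_n) :
  (cons_rV p : 'rV[R]_n.+1) ord0 (lift ord0 i) = (p.2 : 'rV[R]_n) ord0 i.
Proof.
rewrite (_ : lift ord0 i = rshift 1 i); last exact: val_inj.
exact: row_mxEr.
Qed.

Lemma measurable_cons_rV n : measurable_fun setT (@cons_rV n).
Proof.
apply: measurable_fun_borel_rV => i; case: (unliftP ord0 i) => [j|] ->.
  under eq_fun do rewrite cons_rVS.
  exact: (measurableT_comp (measurable_borel_coord j) measurable_snd).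
under eq_fun do rewrite cons_rV0.
exact: measurable_fst.
Qed.

Section step.
Variables (n : nat) (mu : {sigma_finite_measure set (borel_rV R n) -> \bar R}).

Definition lebesgue_rVS : set (borel_rV R n.+1) -> \bar R :=
  pushforward (lebesgue_measure \x mu)%E (@cons_rV n).


Let pf_measure : {measure set (borel_rV R n.+1) -> \bar R} :=
  measure_function_pushforward__canonical__measure_function_Measure
    (lebesgue_measure \x mu)%E (@measurable_cons_rV n).

HB.instance Definition _ := isMeasure.Build _ _ _ lebesgue_rVS
  (measure0 pf_measure) (measure_ge0 pf_measure)
  (@measure_semi_sigma_additive _ _ _ pf_measure).

Let sigma_finite_lebesgue_rVS : sigma_finite setT lebesgue_rVS.
Proof.
pose g (x : borel_rV R n.+1) : measurableTypeR R * borel_rV R n :=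
  ((x : 'rV[R]_n.+1) ord0 ord0, rsubmx (x : 'rV[R]_(1 + n))).
have mg : measurable_fun setT g.
  apply/measurable_fun_pairP; split; first exact: measurable_borel_coord.
  apply: measurable_fun_borel_rV => i /=.
  under eq_fun do rewrite mxE.
  exact: measurable_borel_coord.
have gK : cancel (@cons_rV n) g.
  move=> [x v]; congr (_, _); last exact: row_mxKr.
  exact: cons_rV0.
have /sigma_finiteP[F [TF ndF Foo]] := sigma_finiteT (@lebesgue_measure R).
have /sigma_finiteP[G [TG ndG Goo]] := sigma_finiteT mu.
exists (fun k => g @^-1` (F k `*` G k)).
  apply/seteqP; split=> // x _.
  have [i _ Fi] : (\bigcup_k F k) (g x).1 by rewrite -TF.
  have [j _ Gj] : (\bigcup_k G k) (g x).2 by rewrite -TG.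
  exists (maxn i j) => //; split.
    by move: Fi; exact/subsetPset/ndF/leq_maxl.
  by move: Gj; exact/subsetPset/ndG/leq_maxr.
move=> k; have [mF Fk] := Foo k; have [mG Gk] := Goo k; split.
  by rewrite -[X in measurable X]setTI; apply: mg => //; exact: measurableX.
rewrite /lebesgue_rVS /pushforward.
rewrite (_ : _ @^-1` _ = F k `*` G k).
  by rewrite product_measure1E// lte_mul_pinfty// ge0_fin_numE.
by apply/seteqP; split => x; rewrite /preimage /mkset gK.
Qed.

HB.instance Definition _ := Measure_isSigmaFinite.Build _ _ _ lebesgue_rVS
  sigma_finite_lebesgue_rVS.

End step.

Fixpoint lebesgue_rV n : {sigma_finite_measure set (borel_rV R n) -> \bar R} :=
  match n with
  | 0 => dirac ((0 : 'rV[R]_0) : borel_rV R 0)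
  | m.+1 => lebesgue_rVS (lebesgue_rV m)
  end.

End LebesgueMeasure.

Section Rings.
Context {R : realType} {n : nat}.
Implicit Types (A : set 'rV[R]_n) (C D E : set (rVbar R n)).

Definition diam E : \bar R :=
  if None \in E then +oo%E
  else ereal_sup [set (enorm (x.1 - x.2))%:E |
    x in [set x : 'rV[R]_n * 'rV[R]_n | E (Some x.1) /\ E (Some x.2)]].

Definition uniformly_perfect E :=
  exists c : R, [/\ 0 < c, c < 1 & forall (a : 'rV[R]_n) (r : R),
    E (Some a) -> 0 < r -> (r%:E < diam E)%E ->
    exists x : 'rV[R]_n, E (Some x) /\ c * r < enorm (x - a) < r].

(* Surface measure on the unit sphere, obtained from Lebesgue measure in polar
   coordinates as n times the volume of the cone over [A]. *)
Definition sphere_measure A : \bar R :=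
  (n%:R%:E * lebesgue_rV n [set t *: x | t in `]0%R, 1%R]%classic & x in A]%R)%E.

Definition sphere_area : \bar R :=
  sphere_measure [set x : 'rV[R]_n | enorm x = 1].

(* Values outside [curve_dom] are irrelevant. *)
Record curve := Curve {
  curve_dom : set R;
  curve_map :> R -> rVbar R n;
  curve_dom_itv : is_interval curve_dom;
  curve_dom_nontrivial : exists s t, [/\ curve_dom s, curve_dom t & s < t];
  curve_continuous : {within curve_dom, continuous curve_map}
}.

Definition finite_part (p : rVbar R n) : 'rV[R]_n := odflt 0 p.

Definition path_length (g : R -> 'rV[R]_n) (a b : R) : \bar R :=
  ereal_sup [set (\sum_(i < size s)
      enorm (g (nth b (a :: s) i.+1) - g (nth b (a :: s) i)))%:E |
    s in [set s : seq R | itv_partition a b s]].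

(* The point at which the restriction of [g] to [a, b] has travelled length [u];
   it does not depend on the choice of the parameter [t]. *)
Definition arclength_param (g : R -> 'rV[R]_n) (a b u : R) : 'rV[R]_n :=
  g (xget a [set t | a <= t <= b /\ path_length g a t = u%:E]).

Definition path_integral (rho : 'rV[R]_n -> \bar R) (g : R -> 'rV[R]_n)
    (a b : R) : \bar R :=
  (\int[lebesgue_measure]_(u in `[0%R, fine (path_length g a b)])
     rho (arclength_param g a b u))%E.

Definition locally_rectifiable (gamma : curve) :=
  forall a b : R, a <= b -> `[a, b] `<=` curve_dom gamma ->
    (forall t, t \in `[a, b] -> gamma t <> None) /\
    (path_length (finite_part \o gamma) a b < +oo)%E.

Definition curve_integral (rho : 'rV[R]_n -> \bar R) (gamma : curve) : \bar R :=
  ereal_sup [set path_integral rho (finite_part \o gamma) ab.1 ab.2 |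
    ab in [set ab : R * R |
      ab.1 <= ab.2 /\ `[ab.1, ab.2] `<=` curve_dom gamma]].

Definition admissible (Gamma : set curve) (rho : 'rV[R]_n -> \bar R) :=
  [/\ measurable_fun [set: borel_rV R n] (rho : borel_rV R n -> \bar R),
      forall x, (0 <= rho x)%E
    & forall gamma, Gamma gamma -> locally_rectifiable gamma ->
        (1 <= curve_integral rho gamma)%E].

Definition curve_modulus (Gamma : set curve) : \bar R :=
  ereal_inf [set (\int[lebesgue_rV n]_(x in [set: borel_rV R n])
    (rho x ^+ n))%E | rho in admissible Gamma].

Definition joining_curves C0 C1 D : set curve :=
  [set gamma | exists a b : R,
    [/\ a < b, curve_dom gamma = `[a, b]%classic,
        (C0 (gamma a) /\ C1 (gamma b)) \/ (C1 (gamma a) /\ C0 (gamma b))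
      & forall t, a < t < b -> D (gamma t)]].

Definition continuum C := [/\ C !=set0, connected C & compact C].

Definition filled_continuum C :=
  [/\ continuum C, C <> setT & connected (~` C)].

Record Ring := MkRing {
  ring_compl0 : set (rVbar R n);
  ring_compl1 : set (rVbar R n);
  ring_filled0 : filled_continuum ring_compl0;
  ring_filled1 : filled_continuum ring_compl1;
  ring_disjoint : ring_compl0 `&` ring_compl1 = set0
}.

Definition ring_domain (r : Ring) : set (rVbar R n) :=
  ~` (ring_compl0 r `|` ring_compl1 r).

Definition separates (r : Ring) E :=
  [/\ ring_domain r `&` E = set0,
      ring_compl0 r `&` E !=set0 & ring_compl1 r `&` E !=set0].

Definition ring_curves (r : Ring) : set curve :=
  joining_curves (ring_compl0 r) (ring_compl1 r) (ring_domain r).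

Definition ring_modulus (r : Ring) : \bar R :=
  let M := curve_modulus (ring_curves r) in
  if M == 0%E then +oo%E
  else ((sphere_area / M) `^ (n.-1%:R^-1))%E.

End Rings.
Arguments curve : clear implicits.
Arguments Ring : clear implicits.

(* Main.v *)
(** Lower bound for the modulus. Let [C0] and [C1] be disjoint continua, with
    [a] in [C0] and [b] in [C1] at distance at most [r], each containing points
    at distance [kappa * r] from [a], respectively [b]. By connectedness [C0]
    has a point [p] at each distance [t <= kappa * r] from [a], and likewise
    [C1] has a point [q] at each such distance from [b]. For [rho] with
    [n]-energy [I], the average over [z] in a cube of size [r] of the integral
    of [rho] along the segment [p, z] is at most a small constant plus a
    function of [t] alone whose mean over [0, kappa * r] is [O(I)]. If [I] is
    too small, some broken line from [p] through [z] to [q] has [rho]-length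
    less than 1, and it contains a curve joining [C0] to [C1] in the complement.
    When [E] is uniformly perfect and separated by the ring, such [a] and [b]
    are obtained as an almost closest pair of points of [E] in the two
    complementary continua.

    Conversely, if [E] has a gap [c * r < |x - a| < r], then [E] is separated by
    a ring between two cubes centred at [a]. Giving equal weight to the [k]
    dyadic shells of that ring yields an admissible density of energy
    [O(k ^ (1 - n))], so that the modulus is unbounded as [c] tends to [0]. *)
Require Import Defs.
From HB Require Import structures.
From mathcomp Require Import all_boot all_order all_algebra.
From mathcomp Require Import all_classical all_reals all_analysis.
From mathcomp Require Import measurable_realfun ring lra.
Set Implicit Arguments.
Unset Strict Implicit.
Unset Printing Implicit Defensive.
Import Order.TTheory GRing.Theory Num.Theory.
Import numFieldNormedType.Exports.
Local Open Scope classical_set_scope.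
Local Open Scope ring_scope.

(** * Affine changes of variables and cubes *)

(** The [n]-energy alone does not control line integrals issuing from one fixed point [p]. Young's
    inequality with weight [s^(al - 1)] and the Jacobian [s^n] of the homothety sending [z] to
    [p + s *: (z - p)] leave the factor [s^(al - 2)], which is not integrable at 0; this reflects
    that a point has zero [n]-capacity. A continuum supplies a one-parameter family of starting
    points, indexed by their distance [t] from a centre. A point [x] within [D * s] of the starting
    point confines [t] to an interval of length [2 * D * s], so averaging over [t] gains one power
    of [s]. For [al = n^-1] the weight obtained in this way is again [s^(al - 1)]. The estimates use
    cubes and sup-norm distances, with Tonelli's theorem in place of integration over spheres; the
    Euclidean norm enters through lengths and costs factors [n]. *)

Section LebesgueRV.
Context {R : realType}.
Local Notation mu := (@lebesgue_measure R).

(** The image of [mu] under the map, scaled by [k], agrees with [mu] on half-open intervals, hence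
    everywhere by uniqueness of Lebesgue measure. *)
Lemma ge0_integral_affine (c k : R) (f : R -> \bar R) : 0 < k ->
  measurable_fun [set: measurableTypeR R] f -> (forall x, 0 <= f x)%E ->
  (\int[mu]_x f (c + k * x)%R = (k^-1)%:E * \int[mu]_x f x)%E.
Proof.
move=> k0 mf f0.
pose phi : measurableTypeR R -> measurableTypeR R := fun x => c + k * x.
have mphi : measurable_fun setT phi.
  by apply: measurable_funD => //; apply: measurable_funM.
pose pf := measure_function_pushforward__canonical__measure_function_Measure
    mu mphi.
pose nu : {measure set (measurableTypeR R) -> \bar R} :=
  mscale (NngNum (ltW k0)) pf.
have nuE A : measurable A -> mu A = nu A.
  move=> mA; apply: lebesgue_measure_unique => // _ [[a b]] _ <- /=.
  rewrite /nu /mscale/= /pushforward.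
  have -> : phi @^-1` `]a, b]%classic = `](a - c) / k, (b - c) / k]%classic.
    apply/seteqP; split=> x; rewrite /phi/= !in_itv/=.
      by rewrite ltr_pdivrMr// ler_pdivlMr// ltrBlDl lerBrDl mulrC.
    by rewrite ltr_pdivrMr// ler_pdivlMr// ltrBlDl lerBrDl mulrC.
  rewrite !lebesgue_measure_itv/= !lte_fin ltr_pM2r ?invr_gt0// ltrD2r.
  case: ifPn => _; last by rewrite mule0.
  rewrite -!EFinB -EFinM; congr EFin; field.
  by rewrite gt_eqF.
transitivity (\int[pf]_x f x)%E.
  by rewrite (ge0_integral_pushforward mphi).
rewrite [X in (_ * X)%E](_ : _ = \int[nu]_x f x)%E; last first.
  by apply: eq_measure_integral => A mA _; exact: nuE.
by rewrite ge0_integral_mscale//= muleA -EFinM mulVf ?gt_eqF// mul1e.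
Qed.

Lemma integral_lebesgue_rVS n (f : borel_rV R n.+1 -> \bar R) :
  measurable_fun setT f -> (forall x, 0 <= f x)%E ->
  (\int[lebesgue_rV n.+1]_x f x =
  \int[mu]_x \int[lebesgue_rV n]_y f (cons_rV (x, y)))%E.
Proof.
move=> mf f0.
transitivity (\int[(mu \x lebesgue_rV n)%E]_z f (cons_rV z))%E.
  have := @ge0_integral_pushforward _ _ _ _ R (@cons_rV R n)
    (@measurable_cons_rV R n) (mu \x lebesgue_rV n)%E setT f measurableT mf.
  by rewrite preimage_setT; apply => y _; exact: f0.
rewrite fubini_tonelli1//.
by apply: measurableT_comp mf _; exact: measurable_cons_rV.
Qed.

Lemma eq_rV n (u v : 'rV[R]_n) : (forall i, u ord0 i = v ord0 i) -> u = v.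
Proof. by move=> uv; apply/rowP. Qed.

Lemma measurable_affine_rV n (v : 'rV[R]_n) (k : R) :
  measurable_fun [set: borel_rV R n]
    ((fun x : 'rV[R]_n => v + k *: x) : borel_rV R n -> borel_rV R n).
Proof.
apply: measurable_fun_borel_rV => i /=.
under eq_fun do rewrite !mxE.
apply: measurable_funD => //; apply: measurable_funM => //.
exact: measurable_borel_coord.
Qed.

(** Applied to homotheties of centre [p], where [k ^- n] is the Jacobian; the induction splits off
    the first coordinate, which contributes one factor [k^-1]. *)
Lemma ge0_integral_affine_rV n (v : 'rV[R]_n) (k : R)
    (f : borel_rV R n -> \bar R) : 0 < k ->
  measurable_fun setT f -> (forall x, 0 <= f x)%E ->
  (\int[lebesgue_rV n]_x f (v + k *: x)%R =
   (k ^- n)%:E * \int[lebesgue_rV n]_x f x)%E.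
Proof.
move=> k0; elim: n v f => [|n IH] v f mf f0.
  rewrite expr0 invr1 mul1e; apply: eq_integral => x _; congr f.
  by apply/matrixP => i [].
have mfv : measurable_fun setT (fun x : borel_rV R n.+1 =>
    f ((v + k *: (x : 'rV_n.+1)) : borel_rV R n.+1)).
  by apply: measurableT_comp mf _; exact: measurable_affine_rV.
rewrite !integral_lebesgue_rVS//.
pose v' : 'rV[R]_n := \row_i v ord0 (lift ord0 i).
have affE x y : (v + k *: (cons_rV (x, y) : 'rV_n.+1)) =
    cons_rV (v ord0 ord0 + k * x, (v' + k *: (y : 'rV_n)) : borel_rV R n).
  apply: eq_rV => i; case: (unliftP ord0 i) => [j|] ->.
    transitivity (v ord0 (lift ord0 j) + k * (y : 'rV_n) ord0 j).
      by rewrite 2!mxE (cons_rVS (x, y)).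
    by apply: etrans (esym (cons_rVS _ _)); rewrite /= !mxE.
  transitivity (v ord0 ord0 + k * x); first by rewrite 2!mxE (cons_rV0 (x, y)).
  by apply: etrans (esym (cons_rV0 _)) => /=.
have mfc x : measurable_fun setT (fun y : borel_rV R n => f (cons_rV (x, y))).
  apply: measurableT_comp mf _; apply: measurableT_comp.
    exact: measurable_cons_rV.
  exact: measurable_pair1.
pose g (x : measurableTypeR R) := (\int[lebesgue_rV n]_y f (cons_rV (x, y)))%E.
have mg : measurable_fun setT g.
  apply: (measurable_fun_fubini_tonelli_F (fun z => f (cons_rV z))) => //.
  by apply: measurableT_comp mf _; exact: measurable_cons_rV.
have g0 x : (0 <= g x)%E by apply: integral_ge0.
transitivity (\int[mu]_x ((k ^- n)%:E * g (v ord0 ord0 + k * x)%R))%E.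
  apply: eq_integral => x _; rewrite -(IH v' _ (mfc _))//.
  by apply: eq_integral => y _; rewrite affE.
have mga : measurable_fun setT (fun x : measurableTypeR R =>
    g (v ord0 ord0 + k * x)).
  apply: (measurableT_comp mg).
  by apply: measurable_funD => //; apply: measurable_funM.
rewrite (ge0_integralZl_EFin mu measurableT (fun x _ => g0 _) mga); last first.
  by rewrite invr_ge0 exprn_ge0// ltW.
by rewrite ge0_integral_affine// muleA -EFinM exprS invfM mulrC.
Qed.

(** Given by coordinates, so that it is a product of intervals and its volume follows by induction
    on [n]; [boxP] identifies it with a closed ball of the sup norm. *)
Definition box n (v : 'rV[R]_n) (r : R) : set 'rV[R]_n :=
  [set x | forall i, v ord0 i - r <= x ord0 i <= v ord0 i + r].

Lemma rV_norm_le n (x : 'rV[R]_n) r : 0 <= r ->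
  `|x| <= r <-> forall i, `|x ord0 i| <= r.
Proof.
move=> r0; rewrite [`|x|]mx_normrE; split.
  move=> /bigmax_leP[_ h] i; exact: (h (ord0, i)).
move=> h; apply/bigmax_leP; split=> // -[i j] _ /=.
by rewrite [i]ord1; exact: h.
Qed.

Lemma boxP n (v x : 'rV[R]_n) r : 0 <= r -> box v r x <-> `|x - v| <= r.
Proof.
move=> r0; split=> [bx|/(rV_norm_le _ r0) h i].
  by apply/(rV_norm_le _ r0) => i; rewrite !mxE ler_distl bx.
by have := h i; rewrite !mxE ler_distl.
Qed.

Lemma measurable_box n (v : 'rV[R]_n) r : measurable (box v r : set (borel_rV R n)).
Proof.
have -> : (box v r : set (borel_rV R n)) = \bigcap_(i in [set: 'I_n])
    (fun x : borel_rV R n => (x : 'rV_n) ord0 i) @^-1`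
      `[v ord0 i - r, v ord0 i + r]%classic.
  apply/seteqP; split => x /= bx i; first by move=> _; rewrite /= in_itv/= bx.
  by have := bx i I; rewrite /= in_itv.
apply: fin_bigcap_measurable; first exact: finite_finset.
move=> i _; rewrite -[X in measurable X]setTI.
exact: measurable_borel_coord.
Qed.

Lemma lebesgue_rV_box n (v : 'rV[R]_n) r : 0 <= r ->
  lebesgue_rV n (box v r) = ((r *+ 2) ^+ n)%:E.
Proof.
move=> r0; elim: n v => [|n IH] v.
  rewrite expr0 /= diracE mem_set// => -[]//.
pose v' : 'rV[R]_n := \row_i v ord0 (lift ord0 i).
rewrite /= /lebesgue_rVS /pushforward.
have -> : cons_rV (n:=n) @^-1` box v r =
   `[v ord0 ord0 - r, v ord0 ord0 + r]%classic `*` box v' r.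
  apply/seteqP; split => -[x y] /=.
    move=> bx; split; first by have := bx ord0; rewrite cons_rV0 in_itv.
    by move=> i; have := bx (lift ord0 i); rewrite cons_rVS/= !mxE.
  move=> [/= bx by_] i; case: (unliftP ord0 i) => [j|] ->.
    by rewrite cons_rVS; have := by_ j; rewrite !mxE.
  by rewrite cons_rV0; move: bx; rewrite in_itv.
rewrite product_measure1E//; last exact: measurable_box.
transitivity ((r *+ 2)%:E * ((r *+ 2) ^+ n)%:E)%E; last first.
  by rewrite -EFinM exprS.
congr (_ * _)%E; last exact: IH.
apply: etrans (lebesgue_measure_itv _) _ => /=; rewrite lte_fin.
case: ifPn => [_|]; first by rewrite -EFinB mulr2n; congr EFin; ring.
by rewrite -leNgt mulr2n => rr; congr EFin; move: rr r0; lra.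
Qed.

End LebesgueRV.

Section WeightIntegral.
Context {R : realType}.
Local Notation mu := (@lebesgue_measure R).

(** For [al < 1] the integrand is unbounded at 0. The fundamental theorem of calculus is therefore
    applied on the intervals from [k.+1%:R^-1] to 1, and monotone convergence carries the bound over
    to their union. *)
Lemma ge0_integral_powR_le (al : R) : 0 < al ->
  (\int[mu]_(s in `]0%R, 1%R]) (s `^ (al - 1))%:E <= (al^-1)%:E)%E.
Proof.
move=> al0; pose f (s : R) := s `^ (al - 1).
have mf D : measurable_fun D (EFin \o f).
  by apply/measurable_EFinP; apply: measurable_funTS; exact: measurable_powR.
pose F (k : nat) : set (measurableTypeR R) := `[k.+1%:R^-1, 1]%classic.
have FE : `]0, 1]%classic = \bigcup_k F k.
  apply/seteqP; split=> x /=.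
    rewrite in_itv/= => /andP[x0 x1].
    have [k _ kx] := @near_infty_natSinv_lt R (PosNum x0).
    by exists k => //; rewrite /F/= in_itv/= x1 andbT ltW//; apply: kx => /=.
  move=> [k _]; rewrite /F/= !in_itv/= => /andP[kx ->]; rewrite andbT.
  by apply: lt_le_trans kx; rewrite invr_gt0.
rewrite FE.
have ndF : nondecreasing_seq F.
  apply/nondecreasing_seqP => k; apply/subsetPset => x; rewrite /F/= !in_itv/=.
  move=> /andP[kx ->]; rewrite andbT; apply: le_trans kx.
  by rewrite lef_pV2 ?posrE// ler_nat.
have cv := @ge0_nondecreasing_set_cvg_integral _ (measurableTypeR R) R F (EFin \o f) mu
  ndF (fun k => measurable_itv _) (fun k => mf _)
  (fun k x _ => powR_ge0 _ _).
rewrite -(cvg_lim _ cv)//; apply: lime_le.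
  by apply/cvg_ex; eexists; exact: cv.
apply: nearW => k; rewrite /F.
have [->|k0] := eqVneq k 0%N.
  by rewrite invr1 set_itv1 integral_set1 lee_fin invr_ge0 ltW.
have k1 : (k.+1%:R^-1 < 1 :> R) by rewrite invf_lt1// ltr1n ltnS lt0n.
rewrite (@continuous_FTC2 _ f (fun x => al^-1 * x `^ al))//.
- by rewrite -EFinB lee_fin powR1 -mulrBr ler_piMr// ?invr_ge0 1?ltW//.
- apply: continuous_in_subspaceT => x; rewrite inE/= in_itv/= => /andP[kx _].
  apply: differentiable_continuous; apply/derivable1_diffP.
  apply: derivable_powR; rewrite in_itv/= andbT.
  by apply: lt_le_trans kx; rewrite invr_gt0.
- have cF x : 0 < x -> {for x, continuous (fun x => al^-1 * x `^ al)}.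
    move=> x0; apply: differentiable_continuous; apply/derivable1_diffP.
    by apply: derivableM => //; apply: derivable_powR; rewrite in_itv/= andbT.
  split.
  + move=> x; rewrite in_itv/= => /andP[kx _]; apply: derivableM => //.
    apply: derivable_powR; rewrite in_itv/= andbT.
    by apply: lt_trans kx; rewrite invr_gt0.
  + by apply: cvg_at_right_filter; apply: cF; rewrite invr_gt0.
  + by apply: cvg_at_left_filter; apply: cF.
- move=> x; rewrite in_itv/= => /andP[kx _].
  have x0 : 0 < x by apply: lt_trans kx; rewrite invr_gt0.
  have dP := is_deriveZ (al^-1) (is_derive1_powR al x0).
  rewrite derive1E (derive_val (is_derive := dP)) /f.
  by rewrite -[_ *: _]/(_ * _) mulrA mulVf ?mul1r// gt_eqF.
Qed.

End WeightIntegral.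

(** * Averages of line integrals over segments *)

Section Averaging.
Context {R : realType}.
Local Notation mu := (@lebesgue_measure R).

Lemma continuous_measurable_rV n (f : 'rV[R]_n -> R) : continuous f ->
  measurable_fun [set: borel_rV R n] (f : borel_rV R n -> R).
Proof.
move=> cf; apply: (measurability _ (measurable_realfun.RGenOpens.measurableE R)).
move=> _ [_ [a [b ->]] <-]; rewrite setTI; apply: sub_sigma_algebra.
by apply: open_comp; [move=> x _; exact: cf|exact: interval_open].
Qed.

Lemma measurable_norm_sub n (c : 'rV[R]_n) :
  measurable_fun [set: borel_rV R n]
    ((fun x : 'rV[R]_n => `|x - c|) : borel_rV R n -> R).
Proof.
apply: continuous_measurable_rV => x.
have h1 : continuous (fun y : 'rV[R]_n => y - c).
  by move=> y; apply: continuousB; [exact: cvg_id|exact: cst_continuous].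
exact: continuous_comp (h1 x) (@norm_continuous _ _ (x - c)).
Qed.

Lemma emeasurable_indic_comp d1 (T1 : measurableType d1) d2
    (T2 : measurableType d2) (A : set T2) (f : T1 -> T2) :
  measurable A -> measurable_fun setT f ->
  measurable_fun setT (fun x => (\1_A (f x) : R)%:E).
Proof.
move=> mA mf; apply/measurable_EFinP.
have mA1 : measurable_fun setT (\1_A : T2 -> R) by exact/measurable_indicP.
exact: measurableT_comp mA1 mf.
Qed.

Lemma emeasurable_funX d (T : measurableType d) (D : set T) (f : T -> \bar R) k :
  measurable_fun D f -> measurable_fun D (fun x => f x ^+ k)%E.
Proof.
move=> mf; elim: k => [|k IH]; first exact: measurable_cst.
under eq_fun do rewrite expeS.
exact: emeasurable_funM.
Qed.

(** Up to [A] the first term suffices; above [A] one has [x <= A ^- n.-1 * x ^+ n]. This takes the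
    place of Hoelder's inequality, with a threshold [A] that may vary along the segment. *)
Lemma le_young_expe n (x : \bar R) (A : R) : (0 < n)%N -> 0 < A ->
  (0 <= x -> x <= A%:E + (A ^- n.-1)%:E * x ^+ n)%E.
Proof.
case: n => // n _ A0; case: x => [x| |] //; rewrite ?lee_fin => x0.
  rewrite -EFin_expe -EFinM -EFinD lee_fin/=.
  have [xA|/ltW Ax] := leP x A.
    rewrite (le_trans xA)// lerDl mulr_ge0// ?invr_ge0 ?exprn_ge0// ltW//.
  have xAx : x <= A ^- n * x ^+ n.+1.
    rewrite exprS mulrCA ler_peMr// mulrC ler_pdivlMr ?exprn_gt0// mul1r.
    by apply: lerXn2r; rewrite ?nnegrE// ltW.
  by rewrite (le_trans xAx)// lerDr ltW.
have -> : (+oo ^+ n.+1 = +oo :> \bar R)%E.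
  by elim: n => [|n IH]//; rewrite expeS IH mulyy.
by rewrite gt0_muley ?lte_fin ?invr_gt0 ?exprn_gt0// addey.
Qed.

Variables (n : nat) (rho : 'rV[R]_n -> \bar R).
Hypothesis n0 : (0 < n)%N.
Hypothesis mrho : measurable_fun [set: borel_rV R n] (rho : borel_rV R n -> \bar R).
Hypothesis rho0 : forall x, (0 <= rho x)%E.

(* [w] is integrable on ]0, 1], and [s * g s = w s] holds together with
   [w s ^- n.-1 = s ^+ n * g s]: after the substitution [x = p + s *: (z - p)],
   of Jacobian [s ^+ n], and an integration over a shell of width proportional
   to [s], the two terms of [le_young_expe] with [A = eps * w s] both become
   multiples of [w]. *)
Let al : R := n%:R^-1.
Let I01 : set (measurableTypeR R) := `]0, 1]%classic.
Let w (s : R) : R := \1_I01 s * s `^ (al - 1).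
Let g (s : R) : R := \1_I01 s * s `^ (al - 2).
Let shell (D : R) (c : 'rV[R]_n) (t s : R) (x : 'rV[R]_n) : R :=
  \1_(`]-oo, 0]%classic) (`| `|x - c| - t| - D * s).
(* A bound for the energy seen from a point at distance [t] from [c]; it depends
   on that point through [t] only. *)
Let F (D : R) (c : 'rV[R]_n) (t : R) : \bar R :=
  (\int[mu]_s \int[lebesgue_rV n]_x
    ((g s)%:E * (rho x ^+ n * (shell D c t s x)%:E)))%E.

Let w_ge0 s : 0 <= w s. Proof. by rewrite mulr_ge0// powR_ge0. Qed.
Let g_ge0 s : 0 <= g s. Proof. by rewrite mulr_ge0// powR_ge0. Qed.
Let mI01 : measurable I01. Proof. exact: measurable_itv. Qed.

Let mw : measurable_fun setT w.
Proof. by apply: measurable_funM => //; exact: measurable_powR. Qed.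
Let mg : measurable_fun setT g.
Proof. by apply: measurable_funM => //; exact: measurable_powR. Qed.

Let sg s : s * g s = w s.
Proof.
rewrite /g /w mulrCA indicE; case: (boolP (s \in I01)); last by rewrite !mul0r.
rewrite inE /I01/= in_itv/= => /andP[s0 s1]; rewrite !mul1r.
rewrite -{1}[s]powRr1 ?ltW// -powRD; last first.
  by apply/implyP => _; rewrite gt_eqF.
by congr powR; lra.
Qed.

Let int_w : (\int[mu]_s (w s)%:E <= n%:R%:E)%E.
Proof.
have -> : (\int[mu]_s (w s)%:E = \int[mu]_(s in I01) (s `^ (al - 1))%:E)%E.
  rewrite [RHS]integral_mkcond; apply: eq_integral => s _.
  rewrite patchE /w indicE; case: ifPn => _; by rewrite ?mul1r ?mul0r.
rewrite -[n%:R]invrK; apply: ge0_integral_powR_le.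
by rewrite invr_gt0 ltr0n.
Qed.

Let mshell D c : measurable_fun setT (fun z : (R * R) * borel_rV R n =>
  shell D c z.1.1 z.1.2 z.2).
Proof.
have mi : measurable_fun setT (\1_(`]-oo, 0]%classic) : R -> R).
  by apply/measurable_indicP; exact: measurable_itv.
have mphi : measurable_fun setT (fun z : (R * R) * borel_rV R n =>
    `| `|(z.2 : 'rV_n) - c| - z.1.1| - D * z.1.2).
  apply: measurable_funB; last first.
    apply: measurable_funM => //.
    exact: (measurableT_comp measurable_snd measurable_fst).
  apply: measurableT_comp => //.
  apply: measurable_funB.
    exact: (measurableT_comp (measurable_norm_sub c) measurable_snd).
  exact: (measurableT_comp measurable_fst measurable_fst).
exact: (measurableT_comp mi mphi).
Qed.

Let H D c (z : (R * R) * borel_rV R n) : \bar R :=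
  ((g z.1.2)%:E * (rho z.2 ^+ n * (shell D c z.1.1 z.1.2 z.2)%:E))%E.

Let H_ge0 D c z : (0 <= H D c z)%E.
Proof.
by rewrite /H mule_ge0 ?lee_fin// mule_ge0 ?lee_fin// expe_ge0.
Qed.

Let mH D c : measurable_fun setT (H D c).
Proof.
apply: emeasurable_funM.
  apply/measurable_EFinP; apply: (measurableT_comp mg).
  exact: (measurableT_comp measurable_snd measurable_fst).
apply: emeasurable_funM.
  by apply: emeasurable_funX; exact: (measurableT_comp mrho measurable_snd).
by apply/measurable_EFinP; exact: mshell.
Qed.

Let mrhon : measurable_fun [set: borel_rV R n] (fun x : borel_rV R n => rho x ^+ n)%E.
Proof. exact: emeasurable_funX. Qed.

(** As a condition on [t], membership in the shell says that [t] is within [D * s] of [|x - c|]; the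
    length of this interval is the power of [s] gained by averaging over radii. *)
Let int_shell D c s x : 0 <= D * s ->
  (\int[mu]_t (shell D c t s x)%:E = (2 * D * s)%:E)%E.
Proof.
move=> Ds; set N := `|x - c|.
transitivity (\int[mu]_t
  (\1_(`[N - D * s, N + D * s]%classic : set (measurableTypeR R)) t)%:E)%E.
  apply: eq_integral => t _; congr EFin; rewrite /shell !indicE; congr (_%:R).
  congr nat_of_bool; apply/idP/idP; rewrite !inE/= !in_itv/= -/N subr_le0.
    by rewrite distrC ler_distl.
  by rewrite -ler_distl distrC.
rewrite integral_indic//= setIT.
apply: etrans (lebesgue_measure_itv _) _ => /=; rewrite lte_fin.
case: ifPn => [_|]; first by rewrite -EFinB; congr EFin; ring.
by rewrite -leNgt => rr; congr EFin; move: rr Ds; lra.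
Qed.

Let int_H D c s (x : borel_rV R n) : 0 < D ->
  (\int[mu]_t H D c ((t, s), x) <= (2 * D)%:E * ((w s)%:E * rho x ^+ n))%E.
Proof.
move=> D0; rewrite /H /=.
have [sI|sI] := boolP (s \in I01); last first.
  rewrite (eq_integral (cst 0%E)).
    rewrite integral0 mule_ge0 ?mule_ge0 ?expe_ge0// lee_fin ?w_ge0//.
    by rewrite mulr_ge0// ltW.
  by move=> t _; rewrite /g indicE (negbTE sI) mul0r mul0e.
have s0 : 0 < s by move: sI; rewrite inE /I01/= in_itv/= => /andP[].
have mt : measurable_fun [set: measurableTypeR R] (fun t => (shell D c t s x)%:E).
  apply/measurable_EFinP.
  apply: (measurableT_comp (mshell D c) (g := fun t => ((t, s), x))).
  by apply: measurable_fun_pair => //; apply: measurable_fun_pair.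
have sh0 t : (0 <= (shell D c t s x)%:E)%E by rewrite lee_fin.
rewrite (ge0_integralZl_EFin mu measurableT) //; last 2 first.
- by move=> t _; rewrite mule_ge0 ?expe_ge0.
- by apply: emeasurable_funM => //; exact: measurable_cst.
rewrite (ge0_integralZl mu measurableT) // ?expe_ge0//.
rewrite int_shell; last by rewrite mulr_ge0// ltW.
rewrite [X in (_ * X <= _)%E]muleC !muleA -!EFinM.
by rewrite (_ : g s * (2 * D * s) = 2 * D * w s)// -sg; ring.
Qed.

(** Tonelli lets [t] be integrated first, which turns the weight [g] into [w]; the factor [n%:R]
    bounds the integral of [w]. *)
Let le_int_F D c : 0 < D ->
  (\int[mu]_t F D c t <= (2 * D * n%:R)%:E * \int[lebesgue_rV n]_x (rho x ^+ n))%E.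
Proof.
move=> D0; set I := (\int[lebesgue_rV n]_x (rho x ^+ n))%E.
have I0 : (0 <= I)%E by apply: integral_ge0 => x _; rewrite expe_ge0.
have mK := measurable_fun_fubini_tonelli_F (m2 := lebesgue_rV n) _ (mH D c)
  (H_ge0 D c).
have K0 z : (0 <= fubini_F (lebesgue_rV n) (H D c) z)%E by apply: integral_ge0.
rewrite [leLHS](fubini_tonelli (m1 := mu) (m2 := mu) _ mK K0).
have le_s s : (\int[mu]_t fubini_F (lebesgue_rV n) (H D c) (t, s) <=
    (2 * D)%:E * ((w s)%:E * I))%E.
  have mHs : measurable_fun setT (fun z : measurableTypeR R * borel_rV R n =>
      H D c ((z.1, s), z.2)).
    apply: (measurableT_comp (mH D c)).
    by apply: measurable_fun_pair => //; apply: measurable_fun_pair.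
  rewrite [leLHS](fubini_tonelli (m1 := mu) (m2 := lebesgue_rV n) _ mHs)//.
  rewrite /I -ge0_integralZl//; last 2 first.
    by move=> x _; rewrite expe_ge0.
    by rewrite lee_fin.
  rewrite -(ge0_integralZl_EFin (lebesgue_rV n))//; last 3 first.
  - by move=> x _; rewrite mule_ge0 ?expe_ge0// lee_fin.
  - by apply: emeasurable_funM => //; exact: measurable_cst.
  - by rewrite mulr_ge0// ltW.
  apply: ge0_le_integral => //.
  - by move=> x _; apply: integral_ge0.
  - by apply: (measurable_fun_fubini_tonelli_G (m1 := mu) _ mHs).
  - apply: emeasurable_funM; first exact: measurable_cst.
    by apply: emeasurable_funM => //; exact: measurable_cst.
  - by move=> x _; exact: int_H.
have mwI : measurable_fun [set: measurableTypeR R] (fun s => (w s)%:E * I)%E.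
  by apply: emeasurable_funM; [exact/measurable_EFinP|exact: measurable_cst].
apply: (@le_trans _ _ (\int[mu]_s ((2 * D)%:E * ((w s)%:E * I))))%E.
  apply: ge0_le_integral => //.
  - by move=> s _; apply: integral_ge0.
  - by apply: (measurable_fun_fubini_tonelli_G (m1 := mu) _ mK).
  - by apply: emeasurable_funM => //; exact: measurable_cst.
rewrite (ge0_integralZl_EFin mu measurableT)//; last 2 first.
- by move=> s _; rewrite mule_ge0// lee_fin.
- by rewrite mulr_ge0// ltW.
rewrite ge0_integralZr//; last 2 first.
- exact/measurable_EFinP.
- by move=> s _; rewrite lee_fin.
rewrite [(2 * D * n%:R)%:E]EFinM -muleA; apply: lee_wpmul2l.
  by rewrite lee_fin mulr_ge0// ltW.
by apply: lee_wpmul2r.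
Qed.

(** Mean value argument: if [F] exceeded [cc] throughout [[0, T]], its integral would be at least
    [cc * T]. *)
Let ex_F_le D c T cc : 0 < D -> 0 < T ->
  ((2 * D * n%:R)%:E * \int[lebesgue_rV n]_x (rho x ^+ n) < (cc * T)%:E)%E ->
  exists2 t, 0 <= t <= T & (F D c t <= cc%:E)%E.
Proof.
move=> D0 T0 Ic.
have [cc0|cc0] := ltP cc 0.
  suff : (0 < (cc * T)%:E)%E by rewrite lte_fin pmulr_lgt0// ltNge ltW.
  apply: le_lt_trans Ic; apply: mule_ge0.
    by rewrite lee_fin !mulr_ge0// ltW.
  by apply: integral_ge0 => x _; rewrite expe_ge0.
apply: contrapT => /forall2NP h.
have F0 t : (0 <= F D c t)%E.
  apply: integral_ge0 => s _; apply: integral_ge0 => x _.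
  exact: (H_ge0 D c ((t, s), x)).
have mF : measurable_fun setT (F D c).
  have mK := measurable_fun_fubini_tonelli_F (m2 := lebesgue_rV n) _ (mH D c)
    (H_ge0 D c).
  apply: (measurable_fun_fubini_tonelli_F (m2 := mu) _ mK) => z.
  by apply: integral_ge0.
have mT : measurable (`[0, T]%classic : set (measurableTypeR R)).
  exact: measurable_itv.
suff : ((cc * T)%:E <= \int[mu]_t F D c t)%E.
  by move=> /le_trans/(_ (le_int_F c D0)); rewrite leNgt Ic.
apply: (@le_trans _ _ (\int[mu]_(t in `[0%R, T]) cc%:E)%E).
  have lT : mu (`[0, T]%classic : set (measurableTypeR R)) = T%:E.
    apply: etrans (lebesgue_measure_itv _) _ => /=.
    by rewrite lte_fin T0 oppr0 adde0.
  by rewrite integral_cst// [X in (_ <= _ * X)%E]lT EFinM.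
apply: (@le_trans _ _ (\int[mu]_(t in `[0%R, T]) F D c t)%E).
  apply: ge0_le_integral => //.
  - exact: measurable_funTS.
  - move=> t /= ; rewrite in_itv/= => tT; have [] := h t; first by rewrite tT.
    by move=> /negP; rewrite -ltNge => /ltW.
by apply: ge0_subset_integral.
Qed.

(* The integral of [rho] along the segment [p, z], divided by its length. *)
Definition segment_integral (p z : 'rV[R]_n) : \bar R :=
  (\int[mu]_s ((\1_I01 s)%:E * rho (p + s *: (z - p))%R))%E.

Let h (Q : set (borel_rV R n)) (p : 'rV[R]_n)
    (u : measurableTypeR R * borel_rV R n) : \bar R :=
  ((\1_Q u.2)%:E * ((\1_I01 u.1)%:E * rho (p + u.1 *: ((u.2 : 'rV_n) - p))%R))%E.

Let mline p : measurable_fun setT (fun u : measurableTypeR R * borel_rV R n =>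
  (p + u.1 *: ((u.2 : 'rV_n) - p) : borel_rV R n)).
Proof.
apply: measurable_fun_borel_rV => i /=; under eq_fun do rewrite !mxE.
apply: measurable_funD => //; apply: measurable_funM => //.
apply: measurable_funB => //.
exact: (measurableT_comp (measurable_borel_coord i) measurable_snd).
Qed.

Let mh0 p : measurable_fun setT (fun u : measurableTypeR R * borel_rV R n =>
  ((\1_I01 u.1)%:E * rho (p + u.1 *: ((u.2 : 'rV_n) - p))%R)%E).
Proof.
apply: emeasurable_funM; last exact: (measurableT_comp mrho (mline p)).
by apply: emeasurable_indic_comp.
Qed.

Let mh Q p : measurable Q -> measurable_fun setT (h Q p).
Proof.
move=> mQ; apply: emeasurable_funM; last exact: mh0.
by apply: emeasurable_indic_comp.
Qed.

Let h_ge0 Q p u : (0 <= h Q p u)%E.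
Proof. by rewrite /h !mule_ge0// lee_fin. Qed.

Lemma segment_integral_ge0 p z : (0 <= segment_integral p z)%E.
Proof. by apply: integral_ge0 => s _; rewrite mule_ge0// lee_fin. Qed.

Lemma measurable_segment_integral p :
  measurable_fun [set: borel_rV R n] (segment_integral p).
Proof.
apply: (measurable_fun_fubini_tonelli_G (m1 := mu) _ (mh0 p)) => u.
by rewrite mule_ge0// lee_fin.
Qed.

(** This identity fixes [al]: the exponents of [s] satisfy [(al - 1) * (n - 1) + n + (al - 2) = n *
    al - 1], which vanishes for [al = n^-1]. *)
Let weightE eps s : 0 < eps -> 0 < s <= 1 ->
  (eps * w s) ^- n.-1 = eps ^- n.-1 * (s ^+ n * g s).
Proof.
move=> eps0 /[dup] s01 /andP[s0 _].
have sI : s \in I01 by rewrite inE /I01/= in_itv.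
rewrite exprMn invfM; congr (_ * _).
rewrite /w /g indicE sI !mul1r.
have wu : (s `^ (al - 1)) ^+ n.-1 != 0 by rewrite expf_neq0// gt_eqF// powR_gt0.
apply: (mulfI wu); rewrite mulfV//.
rewrite -!powR_mulrn ?powR_ge0 1?ltW// -powRrM.
rewrite -!powRD; try by apply/implyP => _; rewrite gt_eqF.
rewrite (_ : _ + _ = 0) ?powRr0//.
have -> : n.-1%:R = n%:R - 1 :> R by rewrite -subn1 natrB.
by rewrite /al; field; rewrite pnatr_eq0 -lt0n.
Qed.

(** At parameter [s] the point [y] of the segment from [p] to [z] is within [D * s] of [p], so
    [|y - c|] is within [D * s] of [|p - c|], that is, [y] lies in the shell for [t = |p - c|]. In
    this way the position of [p] enters the bound only through its distance from [c]. *)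
Let le_int_h (Q : set (borel_rV R n)) (p c : 'rV[R]_n) D eps q s :
  measurable Q -> lebesgue_rV n Q = q%:E -> 0 <= q -> 0 < D -> 0 < eps ->
  (forall z : 'rV_n, Q z -> `|z - p| <= D) ->
  (\int[lebesgue_rV n]_z h Q p (s, z) <= (eps * w s * q)%:E +
    (eps ^- n.-1)%:E * \int[lebesgue_rV n]_x H D c ((`|p - c|%R, s), x))%E.
Proof.
move=> mQ Qq q0 D0 eps0 hQ.
have RHS0 : (0 <= (eps * w s * q)%:E +
    (eps ^- n.-1)%:E * \int[lebesgue_rV n]_x H D c ((`|p - c|%R, s), x))%E.
  apply: adde_ge0.
    by rewrite lee_fin; exact: mulr_ge0 (mulr_ge0 (ltW eps0) (w_ge0 s)) q0.
  apply: mule_ge0; last exact: integral_ge0.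
  by rewrite lee_fin invr_ge0 exprn_ge0// ltW.
have [sI|sI] := boolP (s \in I01); last first.
  rewrite (eq_integral (cst 0%E)) ?integral0// => z _.
  by rewrite /h/= !indicE (negbTE sI) mul0e mule0.
have /andP[s0 s1] : 0 < s <= 1 by move: sI; rewrite inE /I01/= in_itv.
pose H1 (y : borel_rV R n) := H D c ((`|p - c|, s), y).
have mH1 : measurable_fun setT H1.
  apply: (measurableT_comp (mH D c)).
  by apply: measurable_fun_pair => //; apply: measurable_fun_pair.
pose y (z : borel_rV R n) : borel_rV R n := (1 - s) *: p + s *: (z : 'rV_n).
have yE z : p + s *: ((z : 'rV_n) - p) = y z :> 'rV_n.
  by rewrite /y scalerBr scalerBl scale1r addrA addrAC.
have my : measurable_fun setT y by exact: measurable_affine_rV.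
have mh1 : measurable_fun setT (fun z => h Q p (s, z)).
  by apply: (measurableT_comp (mh p mQ)); exact: measurable_fun_pair.
pose K := eps ^- n.-1 * s ^+ n.
have K0 : 0 <= K.
  by rewrite mulr_ge0 ?invr_ge0 ?exprn_ge0// ltW.
have hle z : (h Q p (s, z) <= (eps * w s)%:E * (\1_Q z)%:E + K%:E * H1 (y z))%E.
  rewrite /h /= indicE; have [zQ|zQ] := boolP (z \in Q); last first.
    rewrite mul0e mule0 add0e; apply: mule_ge0 => //.
    by rewrite H_ge0.
  rewrite indicE sI !mulr1n !mul1e mule1 yE.
  have A0 : 0 < eps * w s.
    by rewrite mulr_gt0// /w indicE sI mul1r powR_gt0.
  apply: le_trans (le_young_expe n0 A0 (rho0 _)) _.
  rewrite leeD2l//= weightE ?s0// /H1 /H /=.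
  have -> : shell D c `|p - c| s (y z) = 1.
    rewrite /shell indicE mem_set//= in_itv/= subr_le0.
    apply: le_trans (ler_dist_dist _ _) _.
    rewrite -yE opprB addrA subrK addrC addKr normrZ gtr0_norm// mulrC ler_pM2r//.
    by apply: hQ; rewrite inE in zQ.
  by rewrite mule1 muleA -EFinM /K mulrA.
have HyE : (\int[lebesgue_rV n]_z H1 (y z) =
    (s ^- n)%:E * \int[lebesgue_rV n]_x H1 x)%E.
  exact: (ge0_integral_affine_rV ((1 - s) *: p) s0 mH1 (fun x => H_ge0 _ _ _)).
apply: (@le_trans _ _ (\int[lebesgue_rV n]_z
    ((eps * w s)%:E * (\1_Q z)%:E + K%:E * H1 (y z)))%E).
  apply: ge0_le_integral => // [|z _]; last exact: hle.
  apply: emeasurable_funD; apply: emeasurable_funM => //; try exact: measurable_cst.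
    by apply/measurable_EFinP; exact/measurable_indicP.
  exact: measurableT_comp mH1 my.
rewrite ge0_integralD//; last 4 first.
- by move=> z _; rewrite mule_ge0 ?lee_fin// mulr_ge0// ltW.
- apply: emeasurable_funM; first exact: measurable_cst.
  by apply/measurable_EFinP; exact/measurable_indicP.
- by move=> z _; rewrite mule_ge0 ?H_ge0.
- by apply: emeasurable_funM; [exact: measurable_cst|exact: measurableT_comp mH1 my].
rewrite (ge0_integralZl_EFin (lebesgue_rV n))//; last 2 first.
- by apply/measurable_EFinP; exact/measurable_indicP.
- by rewrite mulr_ge0// ltW.
have iQ : (\int[lebesgue_rV n]_z (\1_Q z)%:E)%E = q%:E.
  by rewrite integral_indic// setIT; exact: Qq.
rewrite iQ.
rewrite (ge0_integralZl_EFin (lebesgue_rV n))//; last 2 first.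
- by move=> z _; exact: H_ge0.
- exact: measurableT_comp mH1 my.
rewrite HyE muleA -!EFinM leeD2l//= /K -mulrA mulfV ?mulr1//.
by rewrite expf_neq0// gt_eqF.
Qed.

Let le_int_segment (Q : set (borel_rV R n)) (p c : 'rV[R]_n) D eps q :
  measurable Q -> lebesgue_rV n Q = q%:E -> 0 <= q -> 0 < D -> 0 < eps ->
  (forall z : 'rV_n, Q z -> `|z - p| <= D) ->
  (\int[lebesgue_rV n]_z ((\1_Q z)%:E * segment_integral p z) <=
    (eps * n%:R * q)%:E + (eps ^- n.-1)%:E * F D c `|p - c|%R)%E.
Proof.
move=> mQ Qq q0 D0 eps0 hQ.
have E0 : 0 <= eps ^- n.-1 by rewrite invr_ge0 exprn_ge0// ltW.
have hE z : ((\1_Q z)%:E * segment_integral p z = \int[mu]_s h Q p (s, z))%E.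
  rewrite /segment_integral -(ge0_integralZl_EFin mu)//.
  - by move=> s _; rewrite mule_ge0// lee_fin.
  - exact: measurableT_comp (mh0 p) (measurable_pair2 z).
rewrite (eq_integral _ _ (fun z _ => hE z)).
rewrite -[leLHS](fubini_tonelli (m1 := mu) (m2 := lebesgue_rV n) _
  (mh p mQ) (h_ge0 Q p)).
pose K s := fubini_F (lebesgue_rV n) (H D c) (`|p - c|, s).
have K0 s : (0 <= K s)%E by apply: integral_ge0 => x _; exact: H_ge0.
have mK : measurable_fun setT K.
  apply: (measurableT_comp (measurable_fun_fubini_tonelli_F (m2 := lebesgue_rV n)
     _ (mH D c) (H_ge0 D c))).
  exact: measurable_fun_pair.
have mew : measurable_fun setT (fun s => (eps * w s * q)%:E).
  by apply/measurable_EFinP; do 2 apply: measurable_funM => //.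
apply: (@le_trans _ _ (\int[mu]_s ((eps * w s * q)%:E + (eps ^- n.-1)%:E * K s))%E).
  apply: ge0_le_integral => //.
  - by move=> s _; apply: integral_ge0 => z _; exact: h_ge0.
  - exact: (measurable_fun_fubini_tonelli_F (m2 := lebesgue_rV n) _
      (mh p mQ) (h_ge0 Q p)).
  - by apply: emeasurable_funD => //; apply: emeasurable_funM => //.
  - by move=> s _; exact: le_int_h.
rewrite ge0_integralD//; last 3 first.
- by move=> s _; rewrite lee_fin; exact: mulr_ge0 (mulr_ge0 (ltW eps0) (w_ge0 s)) q0.
- by move=> s _; rewrite mule_ge0.
- by apply: emeasurable_funM.
rewrite (ge0_integralZl_EFin mu)//; apply: leeD => //.
under eq_integral do rewrite mulrAC EFinM.
rewrite (ge0_integralZl_EFin mu)//; last 3 first.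
- by move=> s _; rewrite lee_fin.
- exact/measurable_EFinP.
- by rewrite mulr_ge0// ltW.
rewrite (mulrAC eps) [(eps * q * n%:R)%:E]EFinM; apply: lee_wpmul2l => //.
by rewrite lee_fin mulr_ge0// ltW.
Qed.

(** Solves [cc * (kappa * r) = 2 * D * n%:R * (loewner_const * kappa)] for the quantities [cc] and
    [D] of [ex_short_segments]. All powers of [r] cancel, in accordance with the scale invariance of
    the modulus. *)
Definition loewner_const : R :=
  2 ^+ n * (24 * n%:R ^+ 2) ^- n.-1 / (144 * n%:R ^+ 2).

Lemma loewner_const_gt0 : 0 < loewner_const.
Proof.
by rewrite !mulr_gt0// ?invr_gt0 ?exprn_gt0 ?mulr_gt0 ?exprn_gt0 ?ltr0n.
Qed.

(* As [F D a] and [F D b] have small integrals over [0, kappa * r], radii [t] and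
   [u] with small values exist without any measurable selection of [P] and [Q];
   then [z] is found by averaging over a cube. *)
Lemma ex_short_segments (a b : 'rV[R]_n) (r kappa : R) (P Q : R -> 'rV[R]_n) :
  0 < r -> 0 < kappa -> kappa <= 1 -> `|a - b| <= r ->
  (\int[lebesgue_rV n]_x (rho x ^+ n) < (loewner_const * kappa)%:E)%E ->
  (forall t, 0 <= t <= kappa * r -> `|P t - a| = t) ->
  (forall t, 0 <= t <= kappa * r -> `|Q t - b| = t) ->
  exists t u z, [/\ 0 <= t <= kappa * r, 0 <= u <= kappa * r,
    `|z - P t| <= 3 * r, `|z - Q u| <= 3 * r &
    ((3 * r * n%:R)%:E *
      (segment_integral (P t) z + segment_integral (Q u) z) < 1)%E].
Proof.
move=> r0 k0 k1 abr Ilt hP hQ.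
(* [D] bounds the distance from the cube [V] to either endpoint: from [z] to [a], from [a] to [b]
   and from [b] to [Q u] are three distances of at most [r]. *)
pose D := 3 * r; pose V : set (borel_rV R n) := box a r.
(* [eps] and [cc] make both terms of [le_int_segment], namely [eps * n%:R * q] and
   [eps ^- n.-1 * cc], equal to [q / (24 * r * n%:R)]. *)
pose q := (r *+ 2) ^+ n; pose eps := (24 * r * n%:R ^+ 2)^-1.
pose cc := q * eps ^+ n.-1 / (24 * r * n%:R).
have nR : 0 < n%:R :> R by rewrite ltr0n.
have D0 : 0 < D by rewrite mulr_gt0.
have q0 : 0 < q by rewrite exprn_gt0// mulr2n addr_gt0.
have eps0 : 0 < eps by rewrite invr_gt0 !mulr_gt0// exprn_gt0.
have mV : measurable V by exact: measurable_box.
have Vq : lebesgue_rV n V = q%:E by apply: lebesgue_rV_box; exact: ltW.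
have T0 : 0 < kappa * r by rewrite mulr_gt0.
have Tr : kappa * r <= r by rewrite ger_pMl.
have ccE : cc * (kappa * r) = 2 * D * n%:R * (loewner_const * kappa).
  have qE : q = 2 ^+ n * (r * r ^+ n.-1).
    by rewrite /q -exprS prednK// -[r *+ 2]mulr_natl exprMn.
  have eE : eps ^+ n.-1 = (r ^+ n.-1 * (24 * n%:R ^+ 2) ^+ n.-1)^-1.
    rewrite /eps exprVn -exprMn; congr (_ ^-1).
    by have -> : 24 * r * n%:R ^+ 2 = r * (24 * n%:R ^+ 2) by ring.
  rewrite /cc qE eE /D /loewner_const.
  set m := n.-1; set N := n%:R; set B := (24 * N ^+ 2) ^+ m.
  have B0 : B != 0 by rewrite expf_neq0// gt_eqF// mulr_gt0// exprn_gt0.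
  have N0 : N != 0 by rewrite gt_eqF.
  have r1 : r != 0 by rewrite gt_eqF.
  have rm : r ^+ m != 0 by rewrite expf_neq0.
  by field; rewrite B0 N0 r1 rm.
have Icc : ((2 * D * n%:R)%:E * \int[lebesgue_rV n]_x (rho x ^+ n) <
    (cc * (kappa * r))%:E)%E.
  rewrite ccE [X in (_ < X)%E]EFinM lte_pmul2l// lte_fin !mulr_gt0//.
have [t tT Ft] := ex_F_le a D0 T0 Icc.
have [u uT Fu] := ex_F_le b D0 T0 Icc.
have VP z : V z -> `|z - P t| <= D.
  move=> Vz.
  have za : `|z - a| <= r by apply/boxP => //; exact: ltW.
  have : `|z - P t| <= `|z - a| + `|P t - a|.
    by rewrite (distrC (P t)) (le_trans _ (ler_normD _ _))// addrA subrK.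
  rewrite hP// => /le_trans; apply; rewrite /D.
  by move/andP: tT => [_ ?]; lra.
have VQ z : V z -> `|z - Q u| <= D.
  move=> Vz.
  have za : `|z - a| <= r by apply/boxP => //; exact: ltW.
  have : `|z - Q u| <= `|z - a| + `|a - b| + `|Q u - b|.
    rewrite (distrC (Q u)) (_ : z - Q u = z - a + (a - b) + (b - Q u)).
      by apply: le_trans (ler_normD _ _) _; rewrite lerD2r ler_normD.
    by rewrite !addrA !subrK.
  rewrite hQ// => /le_trans; apply; rewrite /D.
  by move/andP: uT => [_ ?]; lra.
(* If every [z] of the cube failed, integration over the cube would give at least its volume [q],
   whereas the two averages, multiplied by [3 * r * n%:R], add up to at most [q / 2]. *)
apply: contrapT => nex.
pose G (z : borel_rV R n) := (segment_integral (P t) z + segment_integral (Q u) z)%E.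
have G0 z : (0 <= G z)%E by rewrite adde_ge0// segment_integral_ge0.
have mG : measurable_fun setT G.
  by apply: emeasurable_funD; exact: measurable_segment_integral.
have K0 : 0 <= 3 * r * n%:R by rewrite !mulr_ge0// ltW.
have Gge z : V z -> (1 <= (3 * r * n%:R)%:E * G z)%E.
  move=> Vz; rewrite leNgt; apply/negP => lt1; apply: nex.
  by exists t, u, z; split => //; [exact: VP|exact: VQ].
have mV1 : measurable_fun setT (fun z : borel_rV R n => (\1_V z : R)%:E).
  exact: (emeasurable_indic_comp (f := id)).
have : (q%:E <= (3 * r * n%:R)%:E * \int[lebesgue_rV n]_z ((\1_V z)%:E * G z))%E.
  rewrite -(ge0_integralZl_EFin (lebesgue_rV n))//; last 2 first.
  - by move=> z _; rewrite mule_ge0// lee_fin.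
  - exact: emeasurable_funM.
  have -> : q%:E = (\int[lebesgue_rV n]_z (\1_V z)%:E)%E.
    by rewrite integral_indic// setIT; exact: esym Vq.
  apply: ge0_le_integral => //.
  - by apply: emeasurable_funM => //; apply: emeasurable_funM.
  - move=> z _; rewrite muleCA indicE; have [zV|_] := boolP (z \in V).
      rewrite !mulr1n mul1e; apply: Gge.
      by rewrite inE in zV.
    by rewrite mul0e.
rewrite /G; under eq_integral do rewrite ge0_muleDr ?segment_integral_ge0//.
rewrite ge0_integralD//; last 4 first.
- by move=> z _; rewrite mule_ge0 ?segment_integral_ge0// lee_fin.
- by apply: emeasurable_funM => //; exact: measurable_segment_integral.
- by move=> z _; rewrite mule_ge0 ?segment_integral_ge0// lee_fin.
- by apply: emeasurable_funM => //; exact: measurable_segment_integral.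
have E0 : 0 <= eps ^- n.-1 by rewrite invr_ge0 exprn_ge0// ltW.
have half p c (v : R) : `|p - c| = v ->
    (forall z : 'rV_n, V z -> `|z - p| <= D) ->
    (F D c v <= cc%:E)%E ->
    (\int[lebesgue_rV n]_z ((\1_V z)%:E * segment_integral p z) <=
     (q / (12 * r * n%:R))%:E)%E.
  move=> pc Vp Fcc; apply: le_trans (le_int_segment c mV Vq (ltW q0) D0 eps0 Vp) _.
  rewrite pc.
  apply: (@le_trans _ _ ((eps * n%:R * q)%:E + (eps ^- n.-1)%:E * cc%:E)%E).
    by apply: leeD => //; apply: lee_wpmul2l.
  rewrite -EFinM -EFinD lee_fin le_eqVlt; apply/orP; left; apply/eqP.
  have -> : eps ^- n.-1 * cc = q / (24 * r * n%:R).
    rewrite /cc -mulrA mulrCA (mulrC q) !mulrA mulVf ?mul1r//.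
      by rewrite mulrC.
    by rewrite expf_neq0// gt_eqF.
  by rewrite /eps; field; rewrite !gt_eqF.
apply/negP; rewrite -ltNge.
apply: (@le_lt_trans _ _ ((3 * r * n%:R)%:E *
    ((q / (12 * r * n%:R))%:E + (q / (12 * r * n%:R))%:E))%E).
  apply: lee_wpmul2l; first by rewrite lee_fin.
  exact: leeD (half _ a t (hP t tT) VP Ft) (half _ b u (hQ u uT) VQ Fu).
rewrite -EFinD -EFinM lte_fin.
have -> : 3 * r * n%:R * (q / (12 * r * n%:R) + q / (12 * r * n%:R)) = q / 2.
  by field; rewrite !gt_eqF.
by rewrite ltr_pdivrMr// mulr_natr mulr2n ltrDl.
Qed.

End Averaging.

(** * Length of curves *)

Section EuclideanNorm.
Context {R : realType}.
Implicit Type n : nat.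

Lemma enorm_ge0 n (x : 'rV[R]_n) : 0 <= enorm x.
Proof. exact: sqrtr_ge0. Qed.

Lemma enorm_sqr n (x : 'rV[R]_n) : enorm x ^+ 2 = \sum_i x ord0 i ^+ 2.
Proof. by rewrite sqr_sqrtr// sumr_ge0// => i _; exact: sqr_ge0. Qed.

Lemma enorm0 n : enorm (0 : 'rV[R]_n) = 0.
Proof.
rewrite /enorm big1 ?sqrtr0// => i _; by rewrite mxE expr0n.
Qed.

Lemma enormZ n (k : R) (x : 'rV[R]_n) : enorm (k *: x) = `|k| * enorm x.
Proof.
rewrite /enorm -sqrtr_sqr -sqrtrM ?sqr_ge0// mulr_sumr; congr Num.sqrt.
by apply: eq_bigr => i _; rewrite mxE exprMn.
Qed.

Lemma enormN n (x : 'rV[R]_n) : enorm (- x) = enorm x.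
Proof. by rewrite -scaleN1r enormZ normrN1 mul1r. Qed.

Lemma enormB n (x y : 'rV[R]_n) : enorm (x - y) = enorm (y - x).
Proof. by rewrite -enormN opprB. Qed.

Lemma norm_coord_le_enorm n (x : 'rV[R]_n) i : `|x ord0 i| <= enorm x.
Proof.
rewrite -sqrtr_sqr ler_wsqrtr// (bigD1 i)//= lerDl sumr_ge0// => j _.
exact: sqr_ge0.
Qed.

Lemma norm_le_enorm n (x : 'rV[R]_n) : `|x| <= enorm x.
Proof.
by apply/(rV_norm_le _ (enorm_ge0 x)) => i; exact: norm_coord_le_enorm.
Qed.

Lemma enorm_eq0 n (x : 'rV[R]_n) : enorm x = 0 -> x = 0.
Proof.
move=> x0; apply/normr0_eq0/eqP; rewrite eq_le normr_ge0 andbT.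
by rewrite -x0 norm_le_enorm.
Qed.

Lemma enorm_le_sum n (x : 'rV[R]_n) : enorm x <= \sum_i `|x ord0 i|.
Proof.
have S0 : 0 <= \sum_i `|x ord0 i| by apply: sumr_ge0.
rewrite -[leRHS]ger0_norm// -sqrtr_sqr ler_wsqrtr// expr2 mulr_suml.
apply: ler_sum => i _; 
  rewrite -[x ord0 i ^+ 2]ger0_norm ?sqr_ge0// normrX expr2 ler_wpM2l//.
by rewrite (bigD1 i)//= lerDl sumr_ge0.
Qed.

Lemma enorm_le_norm n (x : 'rV[R]_n) : enorm x <= n%:R * `|x|.
Proof.
apply: le_trans (enorm_le_sum x) _.
have -> : n%:R * `|x| = \sum_(i < n) `|x| by rewrite sumr_const card_ord mulr_natl.
by apply: ler_sum => i _; exact: (proj1 (rV_norm_le x (normr_ge0 x)) (lexx _)).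
Qed.

(** With [a] and [b] the two norms, the inequality [(u + v) ^+ 2 <= (1 + b / a) * u ^+ 2 + (1 + a /
    b) * v ^+ 2] in each coordinate has weights for which the right sides sum to exactly
    [(a + b) ^+ 2]. *)
Lemma ler_enormD n (x y : 'rV[R]_n) : enorm (x + y) <= enorm x + enorm y.
Proof.
have [x0|x0] := eqVneq (enorm x) 0.
  by rewrite (enorm_eq0 x0) add0r lerDr enorm_ge0.
have [y0|y0] := eqVneq (enorm y) 0.
  by rewrite (enorm_eq0 y0) addr0 lerDl enorm_ge0.
have a0 : 0 < enorm x by rewrite lt_neqAle eq_sym x0 enorm_ge0.
have b0 : 0 < enorm y by rewrite lt_neqAle eq_sym y0 enorm_ge0.
set a := enorm x in a0 *; set b := enorm y in b0 *.
have : enorm (x + y) ^+ 2 <= (a + b) ^+ 2.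
  rewrite enorm_sqr.
  apply: (@le_trans _ _ (\sum_i ((1 + b / a) * x ord0 i ^+ 2 +
                                 (1 + a / b) * y ord0 i ^+ 2))).
    apply: ler_sum => i _; rewrite mxE -subr_ge0.
    set u := x ord0 i; set v := y ord0 i.
    have -> : (1 + b / a) * u ^+ 2 + (1 + a / b) * v ^+ 2 - (u + v) ^+ 2 =
        (b * u - a * v) ^+ 2 / (a * b).
      by field; rewrite !gt_eqF.
    by rewrite divr_ge0 ?sqr_ge0// mulr_ge0// ltW.
  rewrite big_split/= -!mulr_sumr -!enorm_sqr -/a -/b.
  rewrite [leLHS](_ : _ = (a + b) ^+ 2)//.
  by field; rewrite !gt_eqF.
rewrite -ler_sqrt ?sqr_ge0// !sqrtr_sqr !ger0_norm ?enorm_ge0//.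
by rewrite addr_ge0// ltW.
Qed.

End EuclideanNorm.

Section PathLength.
Context {R : realType} {n : nat}.
Implicit Types (g : R -> 'rV[R]_n) (a b c : R).

(** Recursive form of the sum in [path_length], suited to induction on the partition. *)
Fixpoint chord_sum g a (s : seq R) : R :=
  if s is x :: s' then enorm (g x - g a) + chord_sum g x s' else 0.

Lemma chord_sumE g a b s :
  \sum_(i < size s) enorm (g (nth b (a :: s) i.+1) - g (nth b (a :: s) i)) =
  chord_sum g a s.
Proof.
elim: s a => [|x s IH] a; first by rewrite big_ord0.
by rewrite big_ord_recl /= -(IH x).
Qed.

Lemma path_lengthE g a b :
  path_length g a b =
  ereal_sup [set (chord_sum g a s)%:E | s in itv_partition a b].
Proof.
congr ereal_sup; apply/seteqP; split => [_ [s abs <-]|_ [s abs <-]];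
  by exists s => //; rewrite chord_sumE.
Qed.

Lemma chord_sum_cat g a s t :
  chord_sum g a (s ++ t) = chord_sum g a s + chord_sum g (last a s) t.
Proof.
by elim: s a => [|x s IH] a /=; rewrite ?add0r// IH addrA.
Qed.

Lemma chord_sum_le_path_length g a b s : itv_partition a b s ->
  ((chord_sum g a s)%:E <= path_length g a b)%E.
Proof. by move=> abs; rewrite path_lengthE; apply: ereal_sup_ubound; exists s. Qed.

Lemma path_lengthxx g a : path_length g a a = 0%E.
Proof.
rewrite path_lengthE (_ : [set _ | _ in _] = [set 0%E]) ?ereal_sup1//.
apply/seteqP; split => [_ [s /itv_partitionxx -> <-]//|_ ->].
by exists [::] => //; split.
Qed.

Lemma path_length_ge g a b : a <= b -> ((enorm (g b - g a))%:E <= path_length g a b)%E.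
Proof.
rewrite le_eqVlt => /predU1P[<-|ab]; first by rewrite subrr enorm0 path_lengthxx.
apply: le_trans (chord_sum_le_path_length g (itv_partition1 ab)).
by rewrite /= addr0.
Qed.

Lemma path_length_ge0 g a b : a <= b -> (0 <= path_length g a b)%E.
Proof.
by move=> ab; apply: le_trans (path_length_ge g ab); rewrite lee_fin enorm_ge0.
Qed.

Lemma path_lengthDr g a c b : a <= c -> c <= b ->
  (path_length g a c + (enorm (g b - g c))%:E <= path_length g a b)%E.
Proof.
move=> ac; rewrite le_eqVlt => /predU1P[<-|cb].
  by rewrite subrr enorm0 adde0.
rewrite -leeBrDr// [X in (X <= _)%E]path_lengthE.
apply: ge_ereal_sup => _ [s acs <-]; rewrite leeBrDr// -EFinD.
have := chord_sum_le_path_length g (itv_partition_cat acs (itv_partition1 cb)).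
by rewrite chord_sum_cat /= addr0; move: acs => [_ /eqP ->].
Qed.

Lemma path_lengthDl g a c b : a <= c -> c <= b ->
  ((enorm (g c - g a))%:E + path_length g c b <= path_length g a b)%E.
Proof.
rewrite le_eqVlt => /predU1P[<- _|ac cb].
  by rewrite subrr enorm0 add0e.
rewrite addeC -leeBrDr// [X in (X <= _)%E]path_lengthE.
apply: ge_ereal_sup => _ [s cbs <-]; rewrite leeBrDr// -EFinD.
have := chord_sum_le_path_length g (itv_partition_cat (itv_partition1 ac) cbs).
by rewrite /= addrC.
Qed.

(** Induction on the partition: the chord that jumps over [c] is split at [c] by the triangle
    inequality. *)
Lemma path_length_cat_le g a c b : a <= c -> c <= b ->
  (path_length g a b <= path_length g a c + path_length g c b)%E.
Proof.
move=> ac cb; rewrite {1}path_lengthE; apply: ge_ereal_sup => _ [s abs <-].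
elim: s a ac abs => [|x s IH] a ac abs.
  by rewrite adde_ge0// path_length_ge0.
have /= [/andP[ax xs] lb] := abs.
have [cx|xc] := leP c x.
  apply: (@le_trans _ _ ((enorm (g c - g a))%:E +
      (enorm (g x - g c) + chord_sum g x s)%:E)%E).
    rewrite -EFinD lee_fin /= addrA lerD2r.
    have -> : g x - g a = g c - g a + (g x - g c) by rewrite [RHS]addrC addrA subrK.
    exact: ler_enormD.
  apply: leeD; first exact: path_length_ge.
  move: cx; rewrite le_eqVlt => /predU1P[cx|cx].
    rewrite cx subrr enorm0 add0r; apply: chord_sum_le_path_length.
    by split.
  have cxs : itv_partition c b (x :: s) by split => //=; rewrite cx.
  exact: (chord_sum_le_path_length g cxs).
apply: (@le_trans _ _ ((enorm (g x - g a))%:E +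
    (path_length g x c + path_length g c b))%E).
  by rewrite /= EFinD leeD2l// IH// ?(ltW xc)//; split.
rewrite addeA; apply: leeD => //; exact: path_lengthDl (ltW ax) (ltW xc).
Qed.

Lemma path_length_le_lipschitz g a b : a <= b ->
  (forall s t, a <= s -> s <= t -> t <= b -> enorm (g t - g s) <= t - s) ->
  (path_length g a b <= (b - a)%:E)%E.
Proof.
move=> ab lg; rewrite path_lengthE; apply: ge_ereal_sup => _ [s abs <-].
rewrite lee_fin; elim: s a ab lg abs => [|x s IH] a ab lg [/= + /eqP lb].
  by rewrite -lb subrr.
move=> /andP[ax xs].
have xb : x <= b by apply: (@itv_partition_le _ _ _ _ s); split => //; apply/eqP.
have -> : b - a = (x - a) + (b - x) by ring.
apply: lerD; first exact: lg (lexx _) (ltW ax) xb.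
apply: IH => //; last by split => //; apply/eqP.
by move=> u t xu; apply: lg; exact: le_trans (ltW ax) xu.
Qed.

(** Through this comparison the continuity of the total variations of the coordinates passes to arc
    length, in [length_continuous]. *)
Lemma path_length_le_TV g a b : a <= b ->
  (path_length g a b <= \sum_(i < n) total_variation a b (fun t => g t ord0 i))%E.
Proof.
move=> ab; apply: ge_ereal_sup => _ [s abs <-].
apply: (@le_trans _ _ (\sum_(i < n) (variation a b (fun t => g t ord0 i) s)%:E)%E).
  rewrite sumEFin lee_fin /variation.
  under [leRHS]eq_bigr do rewrite big_mkord.
  rewrite exchange_big/=; apply: ler_sum => j _.
  apply: le_trans (enorm_le_sum _) _; apply: ler_sum => i _.
  by rewrite !mxE.
apply: lee_sum => i _; apply: ereal_sup_ubound.
by exists (variation a b (fun t => g t ord0 i) s) => //; exact: variations_variation.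
Qed.

Lemma path_length_bounded_variation g a b i : a <= b ->
  (path_length g a b < +oo)%E -> bounded_variation a b (fun t => g t ord0 i).
Proof.
move=> ab gab; have g0 := path_length_ge0 g ab.
exists (fine (path_length g a b)) => _ [s abs <-].
rewrite -lee_fin fineK; last by rewrite ge0_fin_numE.
apply: le_trans (chord_sum_le_path_length g abs).
rewrite lee_fin -(chord_sumE g a b) /variation big_mkord; apply: ler_sum => j _.
by apply: le_trans (norm_coord_le_enorm _ i); rewrite !mxE.
Qed.

End PathLength.

Section ReflectIntegral.
Context {R : realType}.
Local Notation mu := (@lebesgue_measure R).

(** Serves to run the second edge of a broken line backwards. *)
Lemma ge0_integral_reflect (c : R) (f : R -> \bar R) :
  measurable_fun [set: measurableTypeR R] f -> (forall x, 0 <= f x)%E ->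
  (\int[mu]_x f (c - x)%R = \int[mu]_x f x)%E.
Proof.
move=> mf f0; pose N : measurableTypeR R -> measurableTypeR R := -%R.
have mN : measurable_fun setT N by exact: oppr_measurable.
have mfc : measurable_fun [set: measurableTypeR R] (fun x => f (c + 1 * x)).
  apply: (measurableT_comp mf).
  by apply: measurable_funD => //; apply: measurable_funM.
transitivity (\int[mu]_x (fun x => f (c + 1 * x)%R) (N x))%E.
  by apply: eq_integral => x _; rewrite /N mul1r.
rewrite -[LHS](ge0_integral_pushforward mN mu (D := setT) measurableT mfc)//.
transitivity (\int[mu]_x f (c + 1 * x)%R)%E.
  by apply: eq_measure_integral => //= A mA _; exact: lebesgue_measureN.
by rewrite ge0_integral_affine// invr1 mul1e.
Qed.

End ReflectIntegral.

(** * Broken lines and the lower bound for the modulus *)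

Section Compactification.
Context {R : realType} {n : nat}.

Lemma closed_ball_rV_compact (x : 'rV[R]_n) r : compact [set y | `|y - x| <= r].
Proof.
apply: bounded_closed_compact.
  exists (r + `|x|); split; first by rewrite num_real.
  move=> M rM y /= yx; rewrite -(subrK x y) (le_trans (ler_normD _ _))//.
  by apply/ltW/(le_lt_trans _ rM); rewrite lerD2r.
have -> : [set y | `|y - x| <= r] = (fun y => `|y - x|) @^-1` [set t | t <= r] by [].
apply: closed_comp => [y _|]; last exact: closed_le.
have h1 : continuous (fun y : 'rV[R]_n => y - x).
  by move=> u; apply: continuousB; [exact: cvg_id|exact: cst_continuous].
exact: continuous_comp (h1 y) (@norm_continuous _ _ (y - x)).
Qed.

Lemma closed_ball_rV_closed (x : 'rV[R]_n) r : closed [set y | `|y - x| <= r].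
Proof.
apply: compact_closed; first exact: norm_hausdorff.
exact: closed_ball_rV_compact.
Qed.

Lemma rVbar_hausdorff : hausdorff_space (rVbar R n).
Proof.
apply: one_point_compactification_hausdorff; last exact: norm_hausdorff.
move=> x _; rewrite withinET; exists [set y | `|y - x| <= 1].
  apply/nbhs_ballP; exists 1 => //= y.
  by rewrite mx_norm_ball /ball_/= distrC => /ltW.
by split; [exact: closed_ball_rV_compact|exact: closed_ball_rV_closed].
Qed.

Lemma rVbar_compact_closed (C : set (rVbar R n)) : compact C -> closed C.
Proof. by apply: compact_closed; exact: rVbar_hausdorff. Qed.

Lemma closed_preimage_Some (C : set (rVbar R n)) : closed C ->
  closed [set x : 'rV[R]_n | C (Some x)].
Proof.
move=> cC; apply: (@closed_comp _ _ (Some : 'rV[R]_n -> rVbar R n) C) => // x _.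
exact: one_point_compactification_some_continuous.
Qed.

End Compactification.

Section BrokenLine.
Context {R : realType} {n : nat}.
Local Notation mu := (@lebesgue_measure R).
Variables p z q : 'rV[R]_n.

Let l1 := enorm (z - p).
Let l2 := enorm (q - z).
Let e1 := l1^-1 *: (z - p).
Let e2 := l2^-1 *: (q - z).

(* The broken line from [p] through [z] to [q], parametrized by arc length; a
   degenerate edge has direction [0^-1 *: 0 = 0]. *)
Definition broken_line (u : R) : 'rV[R]_n :=
  p + Num.min u l1 *: e1 + Num.max (u - l1) 0 *: e2.

Local Notation g := broken_line.

Let l10 : 0 <= l1. Proof. exact: enorm_ge0. Qed.
Let l20 : 0 <= l2. Proof. exact: enorm_ge0. Qed.

Let scale_dir (v : 'rV[R]_n) : enorm v *: ((enorm v)^-1 *: v) = v.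
Proof.
have [v0|v0] := eqVneq (enorm v) 0.
  by rewrite (enorm_eq0 v0) !scaler0.
by rewrite scalerA mulfV// scale1r.
Qed.

Let enorm_dir (v : 'rV[R]_n) : enorm v != 0 -> enorm ((enorm v)^-1 *: v) = 1.
Proof.
move=> v0; rewrite enormZ ger0_norm ?invr_ge0 ?enorm_ge0//.
by rewrite mulVf.
Qed.

Let enorm_dir_le1 (v : 'rV[R]_n) : enorm ((enorm v)^-1 *: v) <= 1.
Proof.
have [v0|/enorm_dir -> //] := eqVneq (enorm v) 0.
by rewrite (enorm_eq0 v0) scaler0 enorm0.
Qed.

Lemma broken_line_fst u : u <= l1 -> g u = p + u *: e1.
Proof.
move=> ul; rewrite /broken_line (min_idPl ul) max_r ?subr_le0//.
by rewrite scale0r addr0.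
Qed.

Lemma broken_line_snd u : l1 <= u -> g u = z + (u - l1) *: e2.
Proof.
move=> ul; rewrite /broken_line (min_idPr ul) max_l ?subr_ge0//.
by rewrite scale_dir (addrC p) subrK.
Qed.

Lemma broken_line0 : g 0 = p.
Proof. by rewrite broken_line_fst// scale0r addr0. Qed.

Lemma broken_line_end : g (l1 + l2) = q.
Proof.
by rewrite broken_line_snd ?lerDl// addrAC subrr add0r scale_dir (addrC z) subrK.
Qed.

Lemma broken_line_lipschitz s t : s <= t -> enorm (g t - g s) <= t - s.
Proof.
(* The time [u] splits into the parts [m u] and [M u] spent along the two edges; both are
   nondecreasing, and the directions [e1] and [e2] have norm at most 1. *)
move=> st; pose m u : R := Num.min u l1; pose M u : R := Num.max (u - l1) 0.
have mM u : m u + M u = u.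
  rewrite /m /M; have [ul|/ltW ul] := leP u l1.
    by rewrite max_r ?subr_le0// addr0.
  by rewrite max_l ?subr_ge0// addrC subrK.
have mst : m s <= m t by rewrite /m le_min2 ?lexx.
have Mst : M s <= M t by rewrite /M le_max2// lerD2r.
have -> : g t - g s = (m t - m s) *: e1 + (M t - M s) *: e2.
  rewrite /broken_line -/(m t) -/(m s) -/(M t) -/(M s) !scalerBl.
  by rewrite !opprD !addrA; apply/rowP => i; rewrite !mxE; ring.
have -> : t - s = (m t - m s) + (M t - M s).
  by rewrite -{1}(mM t) -{1}(mM s); ring.
apply: le_trans (ler_enormD _ _) _.
rewrite (enormZ _ e1) (enormZ _ e2) !ger0_norm ?subr_ge0//.
by apply: lerD; apply: ler_piMr; rewrite ?subr_ge0//; exact: enorm_dir_le1.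
Qed.


Lemma broken_line_continuous : continuous g.
Proof.
move=> t; apply/cvgrPdist_lt => e e0; near=> s.
have ts : `|t - s| < e by near: s; exact: cvgr_dist_lt.
apply: le_lt_trans ts; apply: le_trans (norm_le_enorm _) _.
have [st|/ltW st] := leP s t.
  by rewrite ger0_norm ?subr_ge0// broken_line_lipschitz.
by rewrite distrC enormB ger0_norm ?subr_ge0// broken_line_lipschitz.
Unshelve. all: by end_near. Qed.

Let enorm_fst s t : 0 <= s -> s <= t -> t <= l1 -> enorm (g t - g s) = t - s.
Proof.
move=> s0 st tl; rewrite !broken_line_fst//; last exact: le_trans tl.
rewrite opprD addrACA subrr add0r -scalerBl enormZ ger0_norm ?subr_ge0//.
have [l1z|l1n] := eqVneq l1 0; last by rewrite enorm_dir// mulr1.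
have -> : t = s.
  apply/eqP; rewrite eq_le st andbT; apply: le_trans s0.
  by rewrite -l1z.
by rewrite subrr mul0r.
Qed.

Let enorm_snd s t : l1 <= s -> s <= t -> t <= l1 + l2 ->
  enorm (g t - g s) = t - s.
Proof.
move=> s0 st tl; rewrite !broken_line_snd//; last exact: le_trans st.
rewrite opprD addrACA subrr add0r -scalerBl enormZ.
rewrite opprD addrACA -opprD subrr subr0 ger0_norm ?subr_ge0//.
have [l2z|l2n] := eqVneq l2 0; last by rewrite enorm_dir// mulr1.
have -> : t = s.
  by apply/eqP; rewrite eq_le st andbT; move: tl s0; rewrite l2z; lra.
by rewrite subrr mul0r.
Qed.

Lemma path_length_broken_line s t : 0 <= s -> s <= t -> t <= l1 + l2 ->
  path_length g s t = (t - s)%:E.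
Proof.
move=> s0 st tl; apply/eqP; rewrite eq_le; apply/andP; split.
  by apply: path_length_le_lipschitz => // u v _ uv _; exact: broken_line_lipschitz.
have [tl1|lt1] := leP t l1.
  by rewrite -(enorm_fst s0 st tl1) path_length_ge.
have [sl1|ls1] := leP l1 s.
  by rewrite -(enorm_snd sl1 st tl) path_length_ge.
apply: le_trans (path_lengthDl g (ltW ls1) (ltW lt1)).
rewrite (enorm_fst s0 (ltW ls1) (lexx _)).
apply: (@le_trans _ _ ((l1 - s)%:E + (t - l1)%:E)%E).
  by rewrite -EFinD lee_fin; lra.
by rewrite leeD2l// -(enorm_snd (lexx _) (ltW lt1) tl) path_length_ge// ltW.
Qed.

Lemma arclength_broken_line s t u : 0 <= s -> s <= t -> t <= l1 + l2 ->
  0 <= u <= t - s -> arclength_param g s t u = g (s + u).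
Proof.
move=> s0 st tl /andP[u0 ut]; rewrite /arclength_param; congr g.
have su : s <= s + u by rewrite lerDl.
have sut : s + u <= t by move: ut; lra.
case: xgetP => [v _ [/andP[sv vt]]|/(_ (s + u))].
  by rewrite path_length_broken_line ?(le_trans vt)// => -[]; lra.
case; split; first by rewrite su sut.
rewrite path_length_broken_line ?(le_trans sut)//.
by rewrite addrAC subrr add0r.
Qed.

Variable rho : 'rV[R]_n -> \bar R.
Hypothesis mrho : measurable_fun [set: borel_rV R n] (rho : borel_rV R n -> \bar R).
Hypothesis rho0 : forall x, (0 <= rho x)%E.

Let mrholine (c v : 'rV[R]_n) :
  measurable_fun [set: measurableTypeR R] (fun u => rho (c + u *: v)).
Proof.
have ml : measurable_fun [set: measurableTypeR R]
    (fun u => (c + u *: v) : borel_rV R n).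
  apply: measurable_fun_borel_rV => i /=; under eq_fun do rewrite !mxE.
  by apply: measurable_funD => //; apply: measurable_funM.
exact: measurableT_comp mrho ml.
Qed.

Let mrhog : measurable_fun [set: measurableTypeR R] (fun u => rho (g u)).
Proof.
have mgg : measurable_fun [set: measurableTypeR R] (g : R -> borel_rV R n).
  apply: measurable_fun_borel_rV => i.
  apply: continuous_measurable_fun => u.
  exact: continuous_comp (broken_line_continuous (x := u))
    (@coord_continuous _ _ _ ord0 i (g u)).
exact: measurableT_comp mrho mgg.
Qed.

Let indicM_integral (A : set (measurableTypeR R)) (f : R -> \bar R) :
  (\int[mu]_(u in A) f u = \int[mu]_u ((\1_A u)%:E * f u))%E.
Proof.
rewrite integral_mkcond; apply: eq_integral => u _.
by rewrite patchE indicE; case: ifPn => _; rewrite ?mul1e ?mul0e.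
Qed.

Let segment_le (c v : 'rV[R]_n) :
  (\int[mu]_u ((\1_(`[0, enorm v]%classic : set (measurableTypeR R)) u)%:E *
      rho (c + u *: ((enorm v)^-1 *: v))%R) <=
   (enorm v)%:E * \int[mu]_u ((\1_(`]0, 1]%classic : set (measurableTypeR R)) u)%:E *
      rho (c + u *: v)%R))%E.
Proof.
have [v0|v0] := eqVneq (enorm v) 0.
  rewrite v0 mul0e -(indicM_integral `[0, 0]%classic) set_itv1.
  by rewrite integral_set1.
have l0 : 0 < enorm v by rewrite lt_neqAle eq_sym v0 enorm_ge0.
set l := enorm v in v0 l0 *.
rewrite -(indicM_integral `[0, l]%classic) -integral_itv_obnd_cbnd; last first.
  exact: measurable_funTS (mrholine _ _).
rewrite (indicM_integral `]0, l]%classic).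
pose G (u : measurableTypeR R) : \bar R :=
  ((\1_(`]0, l]%classic : set (measurableTypeR R)) u)%:E *
   rho (c + u *: (l^-1 *: v))%R)%E.
have mG : measurable_fun setT G.
  apply: emeasurable_funM; last exact: mrholine.
  by apply/measurable_EFinP; exact/measurable_indicP.
have G0 u : (0 <= G u)%E by rewrite mule_ge0// lee_fin.
have := ge0_integral_affine 0 l0 mG G0.
move=> /(congr1 (fun x => l%:E * x)%E); rewrite muleA -EFinM mulfV// mul1e => <-.
rewrite le_eqVlt; apply/orP; left; apply/eqP; congr (_ * _)%E.
apply: eq_integral => u _; rewrite /G add0r scalerA [l * u * _]mulrAC mulfV// mul1r.
have e : (u \in (`]0, 1]%classic : set R)) = (l * u \in (`]0, l]%classic : set R)).
  apply/idP/idP; rewrite !inE/= !in_itv/=.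
    by rewrite pmulr_rgt0// ger_pMr.
  by rewrite pmulr_rgt0// ger_pMr.
by rewrite !indicE e.
Qed.

(** [A] follows the first edge from [p] and [B] the second one from [q], hence the reflection
    [L - v]; together they dominate [rho] along the whole line. The part between [s] and [t]
    contributes no more, since [rho] is nonnegative. *)
Lemma path_integral_broken_line_le s t : 0 <= s -> s <= t -> t <= l1 + l2 ->
  (path_integral rho g s t <=
    (enorm (z - p))%:E * segment_integral rho p z +
    (enorm (z - q))%:E * segment_integral rho q z)%E.
Proof.
move=> s0 st tL; set L := l1 + l2 in tL.
pose H (v : measurableTypeR R) : \bar R :=
  ((\1_(`[0, L]%classic : set (measurableTypeR R)) v)%:E * rho (g v))%E.
pose A (v : measurableTypeR R) : \bar R :=
  ((\1_(`[0, l1]%classic : set (measurableTypeR R)) v)%:E *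
   rho (p + v *: ((enorm (z - p))^-1 *: (z - p)))%R)%E.
pose B (v : measurableTypeR R) : \bar R :=
  ((\1_(`[0, enorm (z - q)]%classic : set (measurableTypeR R)) v)%:E *
   rho (q + v *: ((enorm (z - q))^-1 *: (z - q)))%R)%E.
have mi (C : set (measurableTypeR R)) : measurable C ->
    measurable_fun setT (fun v => (\1_C v : R)%:E).
  by move=> mC; apply/measurable_EFinP; exact/measurable_indicP.
have mH : measurable_fun setT H.
  by apply: emeasurable_funM => //; apply: mi; exact: measurable_itv.
have mA : measurable_fun setT A.
  by apply: emeasurable_funM; [apply: mi; exact: measurable_itv|exact: mrholine].
have mB : measurable_fun setT B.
  by apply: emeasurable_funM; [apply: mi; exact: measurable_itv|exact: mrholine].
have H0 v : (0 <= H v)%E by rewrite mule_ge0// lee_fin.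
have A0 v : (0 <= A v)%E by rewrite mule_ge0// lee_fin.
have B0 v : (0 <= B v)%E by rewrite mule_ge0// lee_fin.
have mBL : measurable_fun [set: measurableTypeR R] (fun v => B (L - v)).
  by apply: (measurableT_comp mB); exact: measurable_funB.
have HAB v : (H v <= A v + B (L - v)%R)%E.
  rewrite /H indicE; have [|_] := boolP (v \in _); last first.
    by rewrite mul0e adde_ge0.
  rewrite inE/= in_itv/= => /andP[v0 vL]; rewrite mul1e.
  have [vl1|/ltW l1v] := leP v l1.
    rewrite broken_line_fst// /A indicE mem_set/= ?in_itv/= ?v0//.
    by rewrite mul1e leeDl.
  rewrite broken_line_snd// /B indicE mem_set/=; last first.
    by rewrite in_itv/= subr_ge0 vL enormB -/l2 /L/=; move: l1v; lra.
  rewrite mul1e (_ : z + _ = q + (L - v) *: ((enorm (z - q))^-1 *: (z - q))).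
    by rewrite leeDr.
  rewrite enormB -/l2 -(opprB q z) 2!scalerN.
  rewrite -/e2; have {1}-> : q = z + l2 *: e2 by rewrite scale_dir (addrC z) subrK.
  by rewrite -addrA -scalerBl; congr (_ + _ *: _); rewrite /L; ring.
rewrite /path_integral path_length_broken_line//=.
apply: (@le_trans _ _ (\int[mu]_v H v)%E).
  have <- : (\int[mu]_u H (s + 1 * u)%R = \int[mu]_v H v)%E.
    by rewrite ge0_integral_affine// invr1 mul1e.
  have -> : (\int[mu]_(u in `[0%R, (t - s)%R]) rho (arclength_param g s t u) =
      \int[mu]_(u in `[0%R, (t - s)%R]) rho (g (s + 1 * u)%R))%E.
    apply: eq_integral => u; rewrite inE/= in_itv/= => ut.
    by rewrite arclength_broken_line// mul1r.
  have maff : measurable_fun [set: measurableTypeR R] (fun u => s + 1 * u).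
    by apply: measurable_funD => //; apply: measurable_funM.
  rewrite indicM_integral; apply: ge0_le_integral => //.
  - by move=> u _; rewrite mule_ge0// lee_fin.
  - apply: emeasurable_funM; first by apply: mi; exact: measurable_itv.
    exact: (measurableT_comp mrhog maff).
  - exact: (measurableT_comp mH maff).
  move=> u _; rewrite indicE; have [|_] := boolP (u \in _); last first.
    by rewrite mul0e.
  rewrite inE/= in_itv/= mul1r => /andP[u0 ut]; rewrite mul1e.
  rewrite /H indicE mem_set/= ?mul1e// in_itv/= addr_ge0//=.
  by move: ut tL; lra.
apply: (@le_trans _ _ (\int[mu]_v (A v + B (L - v)%R))%E).
  apply: ge0_le_integral => //.
  exact: emeasurable_funD.
rewrite ge0_integralD// ge0_integral_reflect//.
by apply: leeD; exact: segment_le.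
Qed.

End BrokenLine.

(** * Lower bound for the curve modulus of a ring *)

Section RingLowerBound.
Context {R : realType} {n : nat}.

(** If [C] missed the sphere, the open and the closed ball would cut out the same part [B] of [C],
    which would then be open and closed in [C], hence all of [C]. *)
Lemma connected_sphere_meets (C : set (rVbar R n)) (a x : 'rV[R]_n) t :
  connected C -> C (Some a) -> C (Some x) -> 0 <= t <= `|x - a| ->
  exists2 p, C (Some p) & `|p - a| = t.
Proof.
move=> cC Ca Cx /andP[t0 tx].
move: t0; rewrite le_eqVlt => /predU1P[<-|t0].
  by exists a => //; rewrite subrr normr0.
apply: contrapT => nex.
have nt p : C (Some p) -> `|p - a| <> t by move=> Cp pt; apply: nex; exists p.
pose B := C `&` [set Some p | p in [set p : 'rV[R]_n | `|p - a| < t]].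
have : B = C.
  apply: cC.
  - by exists (Some a); split => //; exists a => //=; rewrite subrr normr0.
  - exists [set Some p | p in [set p : 'rV[R]_n | `|p - a| < t]] => //.
    apply: one_point_compactification_open_some.
    have -> : [set p : 'rV[R]_n | `|p - a| < t] = ball a t.
      by rewrite mx_norm_ball; apply/seteqP; split=> p /=; rewrite /ball_/= distrC.
    exact: ball_open.
  - exists [set Some p | p in [set p : 'rV[R]_n | `|p - a| <= t]].
      apply: rVbar_compact_closed; apply: continuous_compact.
        apply: continuous_subspaceT => p.
        exact: one_point_compactification_some_continuous.
      exact: closed_ball_rV_compact.
    apply/seteqP; split=> [w [Cw [p /= pt pE]]|w [Cw [p /= pt pE]]].
      by split => //; exists p => //=; exact: ltW.
    split => //; exists p => //=; rewrite lt_neqAle pt andbT; apply/eqP.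
    by apply: nt; rewrite pE.
move=> BC; have : B (Some x) by rewrite BC.
by case=> _ [p /= pt [px]]; rewrite -px leNgt pt in tx.
Qed.

(** The order of the choices matters: [t] is the first time in [K1], then [s] the last time in [K0]
    before [t]. *)
Lemma closed_first_passage (K0 K1 : set R) (L : R) :
  closed K0 -> closed K1 -> K0 `&` K1 = set0 -> 0 <= L -> K0 0 -> K1 L ->
  exists s t, [/\ 0 <= s, s < t, t <= L, K0 s & K1 t] /\
    forall u, s < u < t -> ~ K0 u /\ ~ K1 u.
Proof.
move=> cK0 cK1 K01 L0 K00 K1L.
have idc A : {within A, continuous (@idfun R)}.
  by apply: continuous_subspaceT => u; exact: cvg_id.
have cpt (K : set R) (c d : R) : closed K -> compact (K `&` `[c, d]).
  move=> cK; apply: (subclosed_compact _ (@segment_compact _ c d)) => //.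
  by apply: closedI => //; exact: interval_closed.
have [|t] := compact_EVT_min _ (cpt K1 0 L cK1) (idc _).
  by exists L; split => //=; rewrite in_itv/= L0 lexx.
rewrite inE/= in_itv/= => -[K1t /andP[t0 tL]] tmin.
have [|s] := compact_EVT_max _ (cpt K0 0 t cK0) (idc _).
  by exists 0; split => //=; rewrite in_itv/= lexx.
rewrite inE/= in_itv/= => -[K0s /andP[s0 st]] smax.
exists s, t; split.
  split => //; rewrite lt_neqAle st andbT; apply/eqP => E.
  have : (K0 `&` K1) t by split => //; rewrite -E.
  by rewrite K01.
move=> u /andP[su ut]; split => [K0u|K1u].
  suff : u <= s by rewrite leNgt su.
  apply: smax; rewrite inE/=; split => //.
  by rewrite in_itv/= (ltW ut) (le_trans s0 (ltW su)).
suff : t <= u by rewrite leNgt ut.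
apply: tmin; rewrite inE/=; split => //.
by rewrite in_itv/= (le_trans s0 (ltW su)) (le_trans (ltW ut) tL).
Qed.

Lemma broken_line_admissible (r : Ring R n) (rho : 'rV[R]_n -> \bar R)
    (p z q : 'rV[R]_n) :
  admissible (ring_curves r) rho ->
  ring_compl0 r (Some p) -> ring_compl1 r (Some q) ->
  (1 <= (enorm (z - p))%:E * segment_integral rho p z +
        (enorm (z - q))%:E * segment_integral rho q z)%E.
Proof.
move=> [mrho rho0 arho] C0p C1q.
pose g := broken_line p z q; pose L := enorm (z - p) + enorm (q - z).
have L0 : 0 <= L by rewrite addr_ge0// enorm_ge0.
pose gb (u : R) : rVbar R n := Some (g u).
have cgb : continuous gb.
  move=> u; apply: (continuous_comp (broken_line_continuous (x := u))).
  exact: one_point_compactification_some_continuous.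
have [[[C00 _ cC0] _ _] [[C10 _ cC1] _ _]] := (ring_filled0 r, ring_filled1 r).
have cK (C : set (rVbar R n)) : compact C -> closed (gb @^-1` C).
  move=> /rVbar_compact_closed cC; apply: closed_comp => // u _; exact: cgb.
have [|||s [t [[s0 st tL C0s C1t] Hst]]] :=
  closed_first_passage (cK _ cC0) (cK _ cC1) _ L0 _ _.
- by rewrite -preimage_setI ring_disjoint preimage_set0.
- by rewrite /gb /g /= broken_line0.
- by rewrite /gb /g /= broken_line_end.
have domi : is_interval (`[s, t]%classic : set R) by exact: interval_is_interval.
have domn : exists u v, [/\ (`[s, t]%classic : set R) u,
    (`[s, t]%classic : set R) v & u < v].
  by exists s, t; rewrite /= !in_itv/= !lexx (ltW st).
pose gam := Curve domi domn (continuous_subspaceT cgb).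
have gamG : ring_curves r gam.
  exists s, t; split => //; first by left.
  by move=> u ut; move=> [?|?]; have [] := Hst _ ut.
have sub a b : a <= b -> (`[a, b] `<=` (`[s, t]%classic : set R)) ->
    [/\ 0 <= a & b <= L].
  move=> ab abst.
  have /= : (`[s, t]%classic : set R) a by apply: abst; rewrite /= in_itv/= lexx.
  have /= : (`[s, t]%classic : set R) b by apply: abst; rewrite /= in_itv/= lexx ab.
  rewrite !in_itv/= => /andP[_ bt] /andP[sa _]; split.
    exact: le_trans sa.
  exact: le_trans tL.
have gamR : locally_rectifiable gam.
  move=> a b ab /(sub _ _ ab)[a0 bL]; split => //.
  by rewrite [path_length _ _ _](path_length_broken_line a0 ab bL) ltry.
apply: le_trans (arho _ gamG gamR) _.
apply: ge_ereal_sup => _ [[a b] /= [ab /(sub _ _ ab)[a0 bL]] <-].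
exact: (path_integral_broken_line_le mrho rho0 a0 ab bL).
Qed.

Lemma curve_modulus_ring_ge (r : Ring R n) (a b x y : 'rV[R]_n)
    (s kappa : R) : (0 < n)%N -> 0 < s -> 0 < kappa -> kappa <= 1 ->
  ring_compl0 r (Some a) -> ring_compl0 r (Some x) -> kappa * s <= `|x - a| ->
  ring_compl1 r (Some b) -> ring_compl1 r (Some y) -> kappa * s <= `|y - b| ->
  `|a - b| <= s ->
  ((loewner_const n * kappa)%:E <= curve_modulus (ring_curves r))%E.
Proof.
move=> n0 s0 k0 k1 C0a C0x kx C1b C1y ky ab.
apply: le_ereal_inf_tmp => _ [rho arho <-]; rewrite leNgt; apply/negP => lt.
have [mrho rho0 _] := arho.
have [[[_ con0 _] _ _] [[_ con1 _] _ _]] := (ring_filled0 r, ring_filled1 r).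
have /choice[P hP] t : exists p, 0 <= t <= kappa * s ->
    ring_compl0 r (Some p) /\ `|p - a| = t.
  have [/andP[t0 tk]|] := boolP (0 <= t <= kappa * s); last by exists 0.
  have [|p ? ?] := connected_sphere_meets (t := t) con0 C0a C0x.
    by rewrite t0 (le_trans tk).
  by exists p.
have /choice[Q hQ] t : exists p, 0 <= t <= kappa * s ->
    ring_compl1 r (Some p) /\ `|p - b| = t.
  have [/andP[t0 tk]|] := boolP (0 <= t <= kappa * s); last by exists 0.
  have [|p ? ?] := connected_sphere_meets (t := t) con1 C1b C1y.
    by rewrite t0 (le_trans tk).
  by exists p.
have [t [u [z [tT uT zP zQ]]]] := ex_short_segments n0 mrho rho0 s0 k0 k1 ab lt
  (fun t tT => (hP t tT).2) (fun t tT => (hQ t tT).2).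
apply/negP; rewrite -leNgt.
apply: le_trans (broken_line_admissible z arho (hP t tT).1 (hQ u uT).1) _.
have c0 : (0 <= (3 * s * n%:R)%:E :> \bar R)%E.
  by rewrite lee_fin !mulr_ge0// ltW.
rewrite [leRHS]ge0_muleDr ?segment_integral_ge0//.
(* Passing from sup-norm distance to Euclidean length costs the factor [n%:R] that
   [ex_short_segments] provides for. *)
have en (v : 'rV[R]_n) : `|v| <= 3 * s -> enorm v <= 3 * s * n%:R.
  move=> vs; apply: le_trans (enorm_le_norm v) _.
  by rewrite [leRHS]mulrC; apply: ler_wpM2l.
by apply: leeD; apply: lee_wpmul2r; rewrite ?segment_integral_ge0// lee_fin en.
Qed.

End RingLowerBound.

(** * Area of the unit sphere, and from curve modulus to ring modulus *)

Section SphereArea.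
Context {R : realType} {n : nat}.

Lemma measurable_enorm :
  measurable_fun [set: borel_rV R n] (@enorm R n : borel_rV R n -> R).
Proof.
have ms : measurable_fun [set: R] (@Num.sqrt R).
  by apply: continuous_measurable_fun; exact: sqrt_continuous.
apply: (measurableT_comp ms); apply: measurable_sum => i.
by apply: measurable_funX; exact: measurable_borel_coord.
Qed.

Lemma sphere_coneE :
  [set t *: x | t in `]0, 1]%classic & x in [set x : 'rV[R]_n | enorm x = 1]] =
  [set x : 'rV[R]_n | 0 < enorm x <= 1].
Proof.
apply/seteqP; split=> [_ [t + [x x1 <-]]|x /= /andP[x0 x1]].
  rewrite /= in_itv/= => /andP[t0 t1].
  by rewrite enormZ x1 mulr1 gtr0_norm// t0.
exists (enorm x); first by rewrite /= in_itv/= x0.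
exists ((enorm x)^-1 *: x) => /=.
  by rewrite enormZ gtr0_norm ?invr_gt0// mulVf// gt_eqF.
by rewrite scalerA mulfV ?scale1r// gt_eqF.
Qed.

Lemma measurable_sphere_cone :
  measurable ([set x | 0 < enorm x <= 1] : set (borel_rV R n)).
Proof.
have -> : ([set x | 0 < enorm x <= 1] : set (borel_rV R n)) =
    (@enorm R n : borel_rV R n -> R) @^-1` `]0, 1]%classic.
  by apply/seteqP; split=> x /=; rewrite in_itv.
by rewrite -[X in measurable X]setTI; exact: measurable_enorm.
Qed.

(** The cone over the sphere is the punctured unit ball; it lies in a cube of radius 1 and contains
    a small cube away from the origin. *)
Lemma sphere_area_gt0_fin : (0 < n)%N ->
  exists2 A : R, 0 < A & @sphere_area R n = A%:E.
Proof.
move=> n0; rewrite /sphere_area /sphere_measure.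
have nR : 0 < n%:R :> R by rewrite ltr0n.
rewrite [X in lebesgue_rV n X]sphere_coneE.
set V := lebesgue_rV n _.
have V1 : (V <= ((1 *+ 2) ^+ n)%:E)%E.
  rewrite -(lebesgue_rV_box (0 : 'rV[R]_n) ler01).
  apply: le_measure; rewrite ?inE; [exact: measurable_sphere_cone|exact: measurable_box|].
  move=> x /= /andP[_ x1]; apply/boxP => //; rewrite subr0.
  exact: le_trans (norm_le_enorm x) x1.
have V0 : (0 < V)%E.
  (* In the cube of radius [h] centred at [v] all coordinates lie between [h] and [3 * h], so
     Euclidean norms are positive and at most [3 * h * n%:R = 3 / 4]. *)
  pose h : R := (4 * n%:R)^-1.
  have h0 : 0 < h by rewrite invr_gt0 mulr_gt0.
  pose v : 'rV[R]_n := const_mx (2 * h).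
  apply: (@lt_le_trans _ _ ((h *+ 2) ^+ n)%:E).
    by rewrite lte_fin exprn_gt0// mulr2n addr_gt0.
  rewrite -(lebesgue_rV_box v (ltW h0)); apply: le_measure; rewrite ?inE.
  - exact: measurable_box.
  - exact: measurable_sphere_cone.
  move=> x bx; have bxi i : h <= x ord0 i <= 3 * h.
    by move: (bx i); rewrite mxE => /andP[? ?]; apply/andP; split; lra.
  apply/andP; split.
    apply: lt_le_trans (norm_coord_le_enorm x (Ordinal n0)).
    by rewrite normr_gt0 gt_eqF// (lt_le_trans h0)//; case/andP: (bxi (Ordinal n0)).
  apply: le_trans (enorm_le_norm x) _.
  apply: (@le_trans _ _ (n%:R * (3 * h))).
    rewrite ler_wpM2l//; apply/rV_norm_le; first by rewrite mulr_ge0// ltW.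
    move=> i; have /andP[x1 x2] := bxi i.
    by rewrite ger0_norm// (le_trans _ x1)// ltW.
  rewrite /h invfM; have -> : n%:R * (3 * (4^-1 * n%:R^-1)) = 3 / 4 :> R.
    by field; rewrite gt_eqF.
  by lra.
have Vfin : V \is a fin_num.
  by rewrite ge0_fin_numE ?ltW//; exact: le_lt_trans V1 (ltry _).
exists (n%:R * fine V); last by rewrite EFinM fineK.
by rewrite mulr_gt0// fine_gt0// V0/= -ge0_fin_numE// ltW.
Qed.

Lemma ring_modulus_le (r : Ring R n) (A d : R) : (2 <= n)%N -> 0 < d ->
  0 <= A -> @sphere_area R n = A%:E ->
  (d%:E <= curve_modulus (ring_curves r))%E ->
  (ring_modulus r <= ((A / d) `^ (n.-1%:R^-1))%:E)%E.
Proof.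
move=> n2 d0 A0 SA; rewrite /ring_modulus SA.
have e0 : n.-1%:R^-1 != 0 :> R.
  by rewrite invr_eq0 pnatr_eq0 -lt0n -ltnS prednK// (leq_trans _ n2).
case: (curve_modulus _) => [m| |] //.
- rewrite lee_fin => dm; have m0 : 0 < m by exact: lt_le_trans dm.
  rewrite eqe gt_eqF// inver gt_eqF// -EFinM poweR_EFin lee_fin.
  apply: ge0_ler_powR; rewrite ?nnegrE ?invr_ge0 ?divr_ge0 ?(ltW m0) ?(ltW d0)//.
  by rewrite ler_wpM2l// lef_pV2.
(* When the curve modulus is infinite, the ring modulus is 0. *)
- suff : ((A%:E * 0) `^ (n.-1%:R^-1) <= ((A / d) `^ (n.-1%:R^-1))%:E)%E by [].
  by rewrite mule0 poweR_EFin powR0// lee_fin powR_ge0.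
Qed.

End SphereArea.

(** * Points of a uniformly perfect set in the two complementary continua *)

Section Selection.
Context {R : realType} {n : nat}.
Implicit Types C D E : set (rVbar R n).

(** The complement of [C] is a neighbourhood of infinity, so a compact set contains all finite
    points of [C], and these form a closed set. *)
Lemma compact_finite_part C : closed C -> ~ C None ->
  compact [set x : 'rV[R]_n | C (Some x)].
Proof.
move=> cC nC.
have /= : nbhs (None : rVbar R n) (~` C).
  by apply: open_nbhs_nbhs; split => //; exact: closed_openC.
move=> [U [cU _] UC]; apply: subclosed_compact cU _.
  exact: closed_preimage_Some.
move=> x /= Cx; apply: contrapT => nUx.
by apply: (UC (Some x)) => //; left; exists x.
Qed.

(** Around [x] in [K], half the radius of a ball that misses [F] is a valid bound for all nearby
    points; compactness, as a near-covering property, makes the choice of [e] uniform. *)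
Lemma compact_closed_dist (K F : set 'rV[R]_n) : compact K -> closed F ->
  K `&` F = set0 -> exists2 e : R, 0 < e & forall x y, K x -> F y -> e <= `|x - y|.
Proof.
move=> cK cF KF.
have : \forall e \near (0 : R)^'+, K `<=` [set x | forall y, F y -> e <= `|x - y|].
  move/compact_near_coveringP : cK; apply => x Kx.
  have nFx : (~` F) x by move=> Fx; have : (K `&` F) x by []; rewrite KF.
  have /nbhs_ballP[d /= d0 dF] : nbhs x (~` F).
    by apply: open_nbhs_nbhs; split => //; exact: closed_openC.
  near=> x' e => y Fy.
  have x'x : `|x - x'| < d / 2.
    near: x'; apply: cvgr_dist_lt; first exact: cvg_id.
    by rewrite divr_gt0.
  have ed : e < d / 2 by near: e; apply: nbhs_right_lt; rewrite divr_gt0.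
  rewrite leNgt; apply/negP => x'y; apply: (dF y) => //.
  rewrite mx_norm_ball /ball_/= (_ : x - y = (x - x') + (x' - y)).
    rewrite (le_lt_trans (ler_normD _ _))// [ltRHS]splitr ltrD// (lt_trans x'y)//.
  by rewrite addrA subrK.
move=> H; near (0 : R)^'+ => e; exists e => // x y Kx Fy.
have : K `<=` [set x | forall y, F y -> e <= `|x - y|] by near: e.
by apply.
Unshelve. all: by end_near. Qed.

(** If [D] met [E] only at infinity, [diam E] would be infinite and [C] bounded; uniform perfectness
    at a point of [E] in [C], for a large radius, then yields a finite point of [E] outside [C]. *)
Lemma uniformly_perfect_finite_point C D E (c : R) :
  (forall (a : 'rV[R]_n) (r : R), E (Some a) -> 0 < r -> (r%:E < diam E)%E ->
    exists x : 'rV[R]_n, E (Some x) /\ c * r < enorm (x - a) < r) ->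
  0 < c -> closed C -> C `&` D = set0 -> E `<=` C `|` D ->
  C `&` E !=set0 -> D `&` E !=set0 ->
  exists y, D (Some y) /\ E (Some y).
Proof.
move=> up c0 cC CD ECD [pa [Ca Ea]] [[y|] [Dy Ey]]; first by exists y.
apply: contrapT => nD.
have nC : ~ C None by move=> CN; have : (C `&` D) None by []; rewrite CD.
have [a paE] : exists a, pa = Some a.
  by case: pa Ca Ea => [a _ _|/nC//]; exists a.
subst pa; have cpt := compact_finite_part cC nC.
have := compact_bounded cpt.
move=> /ex_strict_bound_gt0[B B0 BK].
(* With [B] a sup-norm bound for [C], [c * r] exceeds the Euclidean distance of any two points of
   [C]. *)
pose r := n%:R * (B + B + 1) / c + 1.
have nR : 0 <= n%:R :> R by [].
have BB : 0 <= B + B + 1 by move: B0; lra.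
have r0 : 0 < r.
  by rewrite ltr_wpDl//; apply: divr_ge0; [exact: mulr_ge0|exact: ltW].
have rd : (r%:E < diam E)%E by rewrite /diam mem_set// ltry.
have [x [Ex /andP[cx _]]] := up a r Ea r0 rd.
have Cx : C (Some x).
  by have [//|Dx] := ECD _ Ex; case: nD; exists x.
suff : enorm (x - a) <= c * r by rewrite leNgt cx.
apply: le_trans (enorm_le_norm _) _.
have -> : c * r = n%:R * (B + B + 1) + c by rewrite /r; field; rewrite gt_eqF.
apply: ler_wpDr; first exact: ltW.
apply: ler_wpM2l => //; apply: le_trans (ler_normB _ _) _.
have := BK x Cx; have := BK a Ca => /= h1 h2.
by lra.
Qed.

(** The radius [s / 2], where [s = enorm (b - a)], is admissible because it is below [diam E], and
    it is below [d], so that the point obtained cannot lie in [D]. The divisor [n%:R] converts to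
    the sup norm. *)
Lemma uniformly_perfect_near_point C D E (c d : R) (a b : 'rV[R]_n) :
  (forall (a : 'rV[R]_n) (r : R), E (Some a) -> 0 < r -> (r%:E < diam E)%E ->
    exists x : 'rV[R]_n, E (Some x) /\ c * r < enorm (x - a) < r) ->
  E `<=` C `|` D -> 0 < d -> d <= enorm (b - a) -> enorm (b - a) < d *+ 2 ->
  E (Some a) -> E (Some b) ->
  (forall y, D (Some y) -> E (Some y) -> d <= enorm (y - a)) ->
  exists2 x, C (Some x) & c / 2 / n%:R * enorm (b - a) <= `|x - a|.
Proof.
move=> up ECD d0 dab abd Ea Eb Dd; set s := enorm (b - a) in dab abd *.
have s0 : 0 < s by exact: lt_le_trans dab.
have sd : ((s / 2)%:E < diam E)%E.
  apply: (@lt_le_trans _ _ s%:E).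
    by rewrite lte_fin ltr_pdivrMr// mulr_natr mulr2n ltrDl.
  rewrite /diam; case: ifPn => _; first exact: leey.
  by apply: ereal_sup_ubound; exists (b, a).
have [x [Ex /andP[cx xs]]] := up a (s / 2) Ea (divr_gt0 s0 (ltr0Sn _ _)) sd.
exists x.
  have [//|Dx] := ECD _ Ex.
  by exfalso; have := Dd _ Dx Ex; move: xs abd; rewrite (mulr2n d); lra.
have n0 : 0 < n%:R :> R.
  rewrite ltr0n lt0n; apply/eqP => n0.
  have : s <= n%:R * `|b - a| by exact: enorm_le_norm.
  have nz : n%:R = 0 :> R by rewrite [X in X%:R]n0.
  by rewrite nz mul0r leNgt s0.
rewrite mulrAC ler_pdivrMr// mulrC.
by apply/ltW/(lt_le_trans _ (le_trans (enorm_le_norm _) _)); [|rewrite mulrC]; lra.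
Qed.

End Selection.

Lemma uniformly_perfect_modulus_bounded (R : realType) (n : nat)
    (E : set (rVbar R n)) : (2 <= n)%N -> uniformly_perfect E ->
  exists M : R, 0 < M /\
    forall r : Ring R n, separates r E -> (ring_modulus r <= M%:E)%E.
Proof.
move=> n2 [c [c0 c1 up]].
have n0 : (0 < n)%N by exact: leq_trans n2.
have nR : 0 < n%:R :> R by rewrite ltr0n.
have [A A0 SA] := @sphere_area_gt0_fin R n n0.
pose kappa : R := c / 2 / n%:R.
have k0 : 0 < kappa by rewrite !divr_gt0.
have k1 : kappa <= 1.
  rewrite /kappa ler_pdivrMr// mul1r (@le_trans _ _ 1)// ?ler1n//.
  by lra.
have d0 : 0 < loewner_const n * kappa by rewrite mulr_gt0// loewner_const_gt0.
exists ((A / (loewner_const n * kappa)) `^ (n.-1%:R^-1)); split.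
  by rewrite powR_gt0// divr_gt0.
move=> r [rE0 C0E C1E]; apply: ring_modulus_le => //; first exact: ltW.
set C := ring_compl0 r in rE0 C0E *; set D := ring_compl1 r in rE0 C1E *.
have [[[_ _ cC] _ _] [[_ _ cD] _ _]] := (ring_filled0 r, ring_filled1 r).
have CD : C `&` D = set0 := ring_disjoint r.
have ECD : E `<=` C `|` D.
  move=> x Ex; apply: contrapT => nx.
  by have : (ring_domain r `&` E) x by []; rewrite rE0.
have EDC : E `<=` D `|` C by rewrite setUC.
have DC : D `&` C = set0 by rewrite setIC.
have clC := rVbar_compact_closed cC; have clD := rVbar_compact_closed cD.
have [b0 [Db0 Eb0]] := uniformly_perfect_finite_point up c0 clC CD ECD C0E C1E.
have [a0 [Ca0 Ea0]] := uniformly_perfect_finite_point up c0 clD DC EDC C1E C0E.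
(* One of [C] and [D] misses infinity, hence has a compact finite part. *)
have [e e0 He] : exists2 e : R, 0 < e &
    forall x y, C (Some x) -> D (Some y) -> e <= enorm (y - x).
  have dis : [set x : 'rV[R]_n | C (Some x)] `&` [set x | D (Some x)] = set0.
    rewrite -subset0 => x [Cx Dx].
    by have : (C `&` D) (Some x) by []; rewrite CD.
  have [CN|CN] := pselect (C None); last first.
    have [e e0 He] := compact_closed_dist (compact_finite_part clC CN)
      (closed_preimage_Some clD) dis.
    exists e => // x y Cx Dy; apply: le_trans (norm_le_enorm _).
    by rewrite distrC; exact: He.
  have DN : ~ D None by move=> DN; have : (C `&` D) None by []; rewrite CD.
  rewrite setIC in dis.
  have [e e0 He] := compact_closed_dist (compact_finite_part clD DN)
    (closed_preimage_Some clC) dis.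
  exists e => // x y Cx Dy; apply: le_trans (norm_le_enorm _).
  exact: He.
(* The separation [e] makes [inf S] positive, so that some pair is at distance less than twice
   [inf S]. *)
pose S := [set enorm (ab.2 - ab.1) | ab in [set ab : 'rV[R]_n * 'rV[R]_n |
  [/\ C (Some ab.1), E (Some ab.1), D (Some ab.2) & E (Some ab.2)]]].
have S0 : S !=set0 by exists (enorm (b0 - a0)); exists (a0, b0).
have lS : lbound S e by move=> _ [[a b] /= [Ca _ Db _] <-]; exact: He.
have hS : has_inf S by split => //; exists e.
have eS : e <= inf S by apply: lb_le_inf.
have d0S : 0 < inf S by exact: lt_le_trans eS.
(* No point of [E] in [D] is closer to [a] than [inf S > enorm (b - a) / 2], so
   the point that uniform perfectness gives near [a] is in [C]. *)
have [_ [[a b] /= [Ca Ea Db Eb] <-] abS] := inf_adherent d0S hS.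
rewrite -mulr2n in abS.
have infS x y : C (Some x) -> E (Some x) -> D (Some y) -> E (Some y) ->
    inf S <= enorm (y - x).
  by move=> *; apply: ge_inf; [exists e|exists (x, y)].
have [x Cx xa] := uniformly_perfect_near_point up ECD d0S (infS _ _ Ca Ea Db Eb) abS Ea Eb
  (fun y Dy Ey => infS _ _ Ca Ea Dy Ey).
have [y Dy yb] : exists2 y, D (Some y) & kappa * enorm (a - b) <= `|y - b|.
  apply: (uniformly_perfect_near_point up EDC d0S _ _ Eb Ea); rewrite 1?enormB//.
    exact: infS.
  by move=> y Cy Ey; rewrite enormB; exact: infS.
rewrite enormB in yb.
apply: (curve_modulus_ring_ge n0 _ k0 k1 Ca Cx xa Db Dy yb).
  exact: lt_le_trans (infS _ _ Ca Ea Db Eb).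
by rewrite distrC; exact: norm_le_enorm.
Qed.

(** * Arc length and the upper bound for cubic rings *)

Section LengthFunction.
Context {R : realType} {n : nat}.
Variables (g : R -> 'rV[R]_n) (a b : R).
Hypotheses (ab : a < b) (gc : {within `[a, b], continuous g}).
Hypothesis gfin : (path_length g a b < +oo)%E.

Let len t := path_length g a t.
Let TV t i := total_variation a t (fun u => g u ord0 i).

Let len_fin t : a <= t -> t <= b -> len t \is a fin_num.
Proof.
move=> at_ tb; rewrite ge0_fin_numE ?path_length_ge0//.
apply: le_lt_trans gfin; apply: le_trans (path_lengthDr g at_ tb).
by rewrite leeDl// lee_fin enorm_ge0.
Qed.

Let coord_bv i : bounded_variation a b (fun u => g u ord0 i).
Proof. by apply: path_length_bounded_variation => //; exact: ltW. Qed.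

Let TV_fin i s t : a <= s -> s <= t -> t <= b ->
  total_variation s t (fun u => g u ord0 i) \is a fin_num.
Proof.
move=> as_ st tb; apply/bounded_variationP => //.
have := bounded_variationl (le_trans as_ st) tb (coord_bv i).
exact: bounded_variationr.
Qed.

Let lenB_le s t : a <= s -> s <= t -> t <= b ->
  fine (len t) - fine (len s) <= \sum_i fine (TV t i) - \sum_i fine (TV s i).
Proof.
move=> as_ st tb.
have := path_length_cat_le g as_ st.
have := path_length_le_TV g st.
have fS i := TV_fin i as_ st tb.
have -> : (\sum_(i < n) total_variation s t (fun u => g u ord0 i) =
    (\sum_i fine (TV t i) - \sum_i fine (TV s i))%:E)%E.
  rewrite -sumrB -sumEFin; apply: eq_bigr => i _.
  rewrite /TV (total_variationD _ as_ st) fineD//; last first.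
    exact: TV_fin (lexx _) as_ (le_trans st tb).
  by rewrite addrAC subrr add0r fineK.
move=> h1 h2.
have : (len t <= len s + (\sum_i fine (TV t i) - \sum_i fine (TV s i))%:E)%E.
  exact: le_trans h2 (leeD2l (path_length g a s) h1).
rewrite -(fineK (len_fin (le_trans as_ st) tb)).
rewrite -(fineK (len_fin as_ (le_trans st tb))) -EFinD lee_fin.
by rewrite -lerBlDl.
Qed.

Let len_mono s t : a <= s -> s <= t -> t <= b ->
  enorm (g t - g s) <= fine (len t) - fine (len s).
Proof.
move=> as_ st tb.
have : (len s + (enorm (g t - g s))%:E <= len t)%E := path_lengthDr g as_ st.
rewrite -(fineK (len_fin (le_trans as_ st) tb)).
rewrite -(fineK (len_fin as_ (le_trans st tb))) -EFinD lee_fin.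
by rewrite -lerBrDl.
Qed.

(** The increments of length are nonnegative and at most those of the sum of the total variations of
    the coordinates, which is continuous because the coordinates are. *)
Lemma length_continuous : {within `[a, b], continuous (fun t => fine (len t))}.
Proof.
have Vc : {within `[a, b], continuous (fun t => \sum_i fine (TV t i))}.
  move=> t; apply: cvg_big => [|i _]; first exact: add_continuous.
  apply: (total_variation_continuous (a := a) (b := b)) => //.
  apply/subspace_continuousP => u uab.
  move/subspace_continuousP : gc => /(_ u uab) gu.
  exact: cvg_comp gu (@coord_continuous _ _ _ ord0 i (g u)).
apply/subspace_continuousP => x xab.
move/subspace_continuousP : Vc => /(_ x xab) Vx.
apply/cvgrPdist_lt => e e0.
move/cvgrPdist_lt : Vx => /(_ e e0).
rewrite !near_withinE; apply: filterS => t Vt tab; have {}Vt := Vt tab.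
apply: le_lt_trans Vt.
move: xab tab; rewrite /= !in_itv/= => /andP[ax xb] /andP[at_ tb].
have [tx|/ltW xt] := leP t x.
  have := lenB_le at_ tx xb; have := len_mono at_ tx xb.
  have := enorm_ge0 (g x - g t) => h0 h1 h2.
  have h3 := le_trans h0 h1; have h4 := le_trans h3 h2.
  by rewrite !ger0_norm.
have := lenB_le ax xt tb; have := len_mono ax xt tb.
have := enorm_ge0 (g t - g x) => h0 h1 h2.
rewrite distrC [leRHS]distrC.
have h3 := le_trans h0 h1; have h4 := le_trans h3 h2.
by rewrite !ger0_norm.
Qed.

Let L := fine (path_length g a b).

(** The intermediate value theorem for the length function excludes the default value of [xget]. *)
Lemma arclength_spec u : 0 <= u <= L ->
  exists t, [/\ a <= t, t <= b, fine (len t) = u & arclength_param g a b u = g t].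
Proof.
move=> uL; rewrite /arclength_param.
case: xgetP => [t _ [/andP[at_ tb] tu]|no].
  by exists t; split => //; rewrite /len tu.
have [|t] := @IVT R _ a b u (ltW ab) length_continuous.
  have -> : fine (len a) = 0 by rewrite /len path_lengthxx.
  have L0 : 0 <= fine (len b) by rewrite fine_ge0// path_length_ge0// ltW.
  by rewrite min_l// max_r.
rewrite in_itv/= => /andP[at_ tb] tu; exfalso; apply: (no t); split.
  by rewrite at_.
by rewrite -tu fineK// len_fin.
Qed.

Lemma arclength_lipschitz u v : 0 <= u <= L -> 0 <= v <= L ->
  `|arclength_param g a b u - arclength_param g a b v| <= `|u - v|.
Proof.
move=> uL vL; have [s [as_ sb <- ->]] := arclength_spec uL.
have [t [at_ tb <- ->]] := arclength_spec vL.
apply: le_trans (norm_le_enorm _) _.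
have [st|/ltW ts] := leP s t.
  by rewrite enormB distrC; apply: le_trans (ler_norm _); exact: len_mono.
by apply: le_trans (ler_norm _); exact: len_mono.
Qed.

(** [xget] may return some [t] other than [a] at which the length is still 0, but then [g t = g a],
    as the chord is bounded by the length. *)
Lemma arclength0 : arclength_param g a b 0 = g a.
Proof.
have L0 : 0 <= L by rewrite fine_ge0// path_length_ge0// ltW.
have [|t [at_ tb t0 ->]] := @arclength_spec 0; first by rewrite lexx.
have := len_mono (lexx a) at_ tb; rewrite t0 /len path_lengthxx subrr => h.
have /eqP : enorm (g t - g a) == 0 by rewrite eq_le h enorm_ge0.
by move=> /enorm_eq0/eqP; rewrite subr_eq0 => /eqP.
Qed.

Lemma arclength_end : arclength_param g a b L = g b.
Proof.
have L0 : 0 <= L by rewrite fine_ge0// path_length_ge0// ltW.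
have [|t [at_ tb t0 ->]] := @arclength_spec L; first by rewrite lexx L0.
have := len_mono at_ tb (lexx b); rewrite t0 subrr => h.
have /eqP : enorm (g b - g t) == 0 by rewrite eq_le h enorm_ge0.
by move=> /enorm_eq0/eqP; rewrite subr_eq0 => /eqP.
Qed.

End LengthFunction.

(** * A density spread over dyadic shells *)

Section ShellDensity.
Context {R : realType} {n : nat}.
Local Notation mu := (@lebesgue_measure R).

(** A first passage between the levels [al] and [be] stays strictly between them, and the Lipschitz
    bound forces it to last at least [be - al]. *)
Lemma lipschitz_crossing_measure (psi : R -> R) (L al be : R) :
  (forall u v, `|psi u - psi v| <= `|u - v|) -> 0 <= L -> al < be ->
  (psi 0 <= al /\ be <= psi L) \/ (be <= psi 0 /\ psi L <= al) ->
  ((be - al)%:E <= mu (`[0%R, L]%classic `&` [set u | al < psi u < be]%R))%E.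
Proof.
move=> lpsi L0 ab H.
have cpsi : continuous psi.
  move=> u; apply/cvgrPdist_lt => e e0; near=> v.
  apply: le_lt_trans (lpsi _ _) _.
  by near: v; apply: cvgr_dist_lt => //; exact: cvg_id.
have cle c : closed [set u | psi u <= c].
  by apply: (@closed_comp _ _ psi [set x | x <= c]) => // u _; exact: cpsi.
have cge c : closed [set u | c <= psi u].
  by apply: (@closed_comp _ _ psi [set x | c <= x]) => // u _; exact: cpsi.
have dis : [set u | psi u <= al] `&` [set u | be <= psi u] = set0.
  by rewrite -subset0 => u [/= h1 h2]; move: ab; rewrite ltNge (le_trans h2).
have [s [t [[s0 st tL] bst inn]]] : exists s t, [/\ [/\ 0 <= s, s < t & t <= L],
    be - al <= t - s & forall u, s < u < t -> al < psi u < be].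
  have [[pa pb]|[pb pa]] := H.
    have [s [t [[s0 st tL Ks Kt] inn]]] :=
      closed_first_passage (cle al) (cge be) dis L0 pa pb.
    exists s, t; split => // [|u /inn[/negP]].
      apply: (@le_trans _ _ (psi t - psi s)); first exact: lerB.
      apply: le_trans (ler_norm _) _; apply: le_trans (lpsi _ _) _.
      by rewrite ger0_norm// subr_ge0 ltW.
    by rewrite -ltNge => -> /negP; rewrite -ltNge.
  rewrite setIC in dis.
  have [s [t [[s0 st tL Ks Kt] inn]]] :=
    closed_first_passage (cge be) (cle al) dis L0 pb pa.
  exists s, t; split => // [|u /inn[/negP]].
    apply: (@le_trans _ _ (psi s - psi t)); first exact: lerB.
    apply: le_trans (ler_norm _) _; apply: le_trans (lpsi _ _) _.
    by rewrite distrC ger0_norm// subr_ge0 ltW.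
  by rewrite -ltNge => h1 /negP; rewrite -ltNge => ->.
apply: (@le_trans _ _ (mu (`]s, t[%classic : set (measurableTypeR R)))).
  have -> : mu (`]s, t[%classic : set (measurableTypeR R)) = (t - s)%:E.
    by apply: etrans (lebesgue_measure_itv _) _ => /=; rewrite lte_fin st EFinB.
  by rewrite lee_fin.
apply: le_measure; rewrite ?inE.
- exact: measurable_itv.
- apply: measurableI; first exact: measurable_itv.
  have -> : [set u | al < psi u < be] = psi @^-1` `]al, be[%classic.
    by apply/seteqP; split=> u /=; rewrite in_itv.
  rewrite -[X in measurable X]setTI.
  exact: (continuous_measurable_fun cpsi).
move=> u /=; rewrite !in_itv/= => /[dup] ust /andP[su ut].
split; last exact: inn.
by rewrite (le_trans s0 (ltW su)) (le_trans (ltW ut)).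
Unshelve. all: by end_near. Qed.

Variables (a : 'rV[R]_n) (s : R) (k : nat).
Hypotheses (s0 : 0 < s) (k0 : (0 < k)%N).

(* The dyadic shells are open, hence pairwise disjoint, and [wt j] gives a
   crossing of the [j]-th one the length [k%:R^-1]. *)
Let rad j : R := s / 2 ^+ j.
Let rad_gt0 j : 0 < rad j. Proof. by rewrite divr_gt0// exprn_gt0. Qed.
Let radS j : rad j = rad j.+1 *+ 2.
Proof. by rewrite /rad exprS -[RHS]mulr_natl; field; rewrite expf_neq0. Qed.

Let rad_le i j : (i <= j)%N -> rad j <= rad i.
Proof.
move=> ij; rewrite /rad ler_pM2l// lef_pV2 ?posrE ?exprn_gt0//.
by rewrite ler_eXn2l ?ltr1n.
Qed.

Let shell j : set (borel_rV R n) := [set x : 'rV[R]_n | rad j.+1 < `|x - a| < rad j].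
Let wt j : R := (k%:R * rad j.+1)^-1.

Let mshell j : measurable (shell j).
Proof.
have -> : shell j = (fun x : 'rV[R]_n => `|x - a|) @^-1` `]rad j.+1, rad j[%classic.
  by apply/seteqP; split=> x /=; rewrite /shell/= in_itv.
rewrite -[X in measurable X]setTI.
exact: measurable_norm_sub.
Qed.

Let wt_ge0 j : 0 <= wt j.
Proof. by rewrite invr_ge0 mulr_ge0// ltW. Qed.

Let shell_inj i j x : shell i x -> shell j x -> i = j.
Proof.
wlog ij : i j / (i < j)%N.
  have [ij|ij|//] := ltngtP i j => H xi xj; first exact: H.
  by apply/esym; exact: H.
move=> /= /andP[xi _] /andP[_ xj].
have := lt_trans xi xj; rewrite ltNge (rad_le ij)//.
Qed.

Definition shell_density (x : 'rV[R]_n) : \bar R :=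
  (\sum_(j < k) (wt j * \1_(shell j) x)%:E)%E.

Lemma shell_density_ge0 x : (0 <= shell_density x)%E.
Proof. by apply: sume_ge0 => j _; rewrite lee_fin mulr_ge0. Qed.

Lemma measurable_shell_density :
  measurable_fun [set: borel_rV R n] (shell_density : borel_rV R n -> \bar R).
Proof.
apply: emeasurable_sum => j; apply/measurable_EFinP.
by apply: measurable_funM.
Qed.

(** By disjointness of the shells the power is taken termwise. A shell lies in a cube of side
    [4 * rad j.+1], which cancels the radius in [wt j], so that every shell costs at most
    [(4 / k%:R) ^+ n]. *)
Lemma integral_shell_density_le : (0 < n)%N ->
  (\int[lebesgue_rV n]_x (shell_density x ^+ n) <= (k%:R * (4 / k%:R) ^+ n)%:E)%E.
Proof.
move=> n0.
have kR : 0 < k%:R :> R by rewrite ltr0n.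
apply: (@le_trans _ _ (\int[lebesgue_rV n]_x
    (\sum_(j < k) (wt j ^+ n)%:E * (\1_(shell j) x)%:E)))%E.
  apply: ge0_le_integral => //.
  - by move=> x _; rewrite expe_ge0 ?shell_density_ge0.
  - by apply: emeasurable_funX; exact: measurable_shell_density.
  - apply: emeasurable_sum => j; apply: emeasurable_funM => //.
    by apply/measurable_EFinP; exact/measurable_indicP.
  move=> x _; have [[j jx]|nx] := pselect (exists j : 'I_k, shell j x).
    rewrite /shell_density (bigD1 j)//= big1 ?adde0; last first.
      move=> i ij; rewrite indicE memNset ?mulr0//= => ix.
      by move/eqP: ij; apply; apply: val_inj; exact: shell_inj ix jx.
    rewrite indicE mem_set// mulr1 -EFin_expe (bigD1 j)//= indicE mem_set// mule1.
    by rewrite leeDl// sume_ge0// => i _; rewrite mule_ge0// lee_fin ?exprn_ge0.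
  rewrite /shell_density big1; last first.
    move=> j _; rewrite indicE memNset ?mulr0//= => jx.
    by apply: nx; exists j.
  rewrite -EFin_expe expr0n gtn_eqF//= sume_ge0// => i _.
  by rewrite mule_ge0// lee_fin ?exprn_ge0.
rewrite ge0_integral_sum//; last 2 first.
- move=> j; apply: emeasurable_funM => //.
  by apply/measurable_EFinP; exact/measurable_indicP.
- by move=> j x _; rewrite mule_ge0// lee_fin ?exprn_ge0.
apply: (@le_trans _ _ (\sum_(j < k) ((4 / k%:R) ^+ n)%:E)%E); last first.
  by rewrite sumEFin lee_fin sumr_const card_ord [leRHS]mulr_natl.
apply: lee_sum => j _.
rewrite (ge0_integralZl_EFin (lebesgue_rV n))//; last 2 first.
- by apply/measurable_EFinP; exact/measurable_indicP.
- by rewrite exprn_ge0.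
rewrite integral_indic// setIT.
apply: (@le_trans _ _ ((wt j ^+ n)%:E * lebesgue_rV n (box a (rad j)))%E).
  apply: lee_wpmul2l; first by rewrite lee_fin exprn_ge0.
  apply: le_measure; rewrite ?inE; [exact: mshell|exact: measurable_box|].
  move=> x /= /andP[_ xj]; apply/boxP; first exact: ltW.
  exact: ltW.
rewrite lebesgue_rV_box; last exact: ltW.
rewrite -EFinM lee_fin -exprMn.
have -> : wt j * (rad j *+ 2) = 4 / k%:R; last by [].
have r1 := rad_gt0 j.+1.
have -> : rad j *+ 2 = 4 * rad j.+1 by rewrite (radS j) -mulrnA mulr_natl.
by rewrite /wt; field; rewrite !gt_eqF.
Qed.

Lemma shell_density_path_integral (g : R -> 'rV[R]_n) (t1 t2 : R) :
  t1 < t2 -> {within `[t1, t2], continuous g} ->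
  (path_length g t1 t2 < +oo)%E ->
  (`|g t1 - a| <= rad k /\ rad 0 <= `|g t2 - a|) \/
  (rad 0 <= `|g t1 - a| /\ `|g t2 - a| <= rad k) ->
  (1 <= path_integral shell_density g t1 t2)%E.
Proof.
move=> t12 gc gfin ends.
have kR : 0 < k%:R :> R by rewrite ltr0n.
pose h u := arclength_param g t1 t2 u; set L := fine (path_length g t1 t2).
have L0 : 0 <= L by rewrite fine_ge0// path_length_ge0// ltW.
(* Clipping the parameter to [[0, L]] makes [psi] Lipschitz on the whole line, as
   [lipschitz_crossing_measure] requires. *)
pose c u : R := Num.max 0 (Num.min u L).
have c0L u : 0 <= c u <= L by rewrite /c le_max lexx/= ge_max L0 ge_min lexx orbT.
have cid u : 0 <= u <= L -> c u = u.
  by move=> /andP[u0 uL]; rewrite /c min_l// max_r.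
have clip u v : `|c u - c v| <= `|u - v|.
  wlog uv : u v / v <= u => [H|].
    by have [/H//|/ltW/H] := leP v u; rewrite distrC [leRHS]distrC.
  have cuv : c v <= c u by rewrite /c le_max2// le_min2.
  rewrite !ger0_norm ?subr_ge0// /c /Num.max /Num.min.
  by do ! case: ifPn; rewrite -?leNgt; lra.
pose psi u := `|h (c u) - a|.
have psil u v : `|psi u - psi v| <= `|u - v|.
  apply: le_trans (clip u v).
  apply: le_trans (arclength_lipschitz t12 gc gfin (c0L u) (c0L v)).
  apply: le_trans (ler_dist_dist _ _) _.
  by rewrite opprB addrA subrK.
have psi0 : psi 0 = `|g t1 - a|.
  by rewrite /psi cid ?lexx// /h arclength0.
have psiL : psi L = `|g t2 - a|.
  by rewrite /psi cid ?lexx ?L0// /h arclength_end.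
have cpsi : continuous psi.
  move=> u; apply/cvgrPdist_lt => e e0; near=> v.
  apply: le_lt_trans (psil _ _) _.
  by near: v; apply: cvgr_dist_lt => //; exact: cvg_id.
pose V j : set (measurableTypeR R) := [set u | rad j.+1 < psi u < rad j].
have mV j : measurable (V j).
  have -> : V j = psi @^-1` `]rad j.+1, rad j[%classic.
    by apply/seteqP; split=> u /=; rewrite in_itv.
  rewrite -[X in measurable X]setTI.
  exact: (continuous_measurable_fun cpsi).
have mL : measurable (`[0, L]%classic : set (measurableTypeR R)).
  exact: measurable_itv.
rewrite /path_integral -/L.
have -> : (\int[mu]_(u in `[0%R, L]) shell_density (arclength_param g t1 t2 u) =
   \int[mu]_(u in `[0%R, L]) \sum_(j < k) ((wt j)%:E * (\1_(V j) u)%:E))%E.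
  apply: eq_integral => u; rewrite inE/= in_itv/= => uL.
  apply: eq_bigr => j _; rewrite EFinM; congr (_ * _)%E; congr EFin.
  rewrite !indicE; congr (nat_of_bool _)%:R; apply/idP/idP; rewrite !inE;
    by rewrite /V/= /psi /h cid.
rewrite ge0_integral_sum//; last 2 first.
- move=> j; apply: emeasurable_funM => //.
  by apply/measurable_EFinP; exact: measurable_indic.
- by move=> j u _; rewrite mule_ge0// lee_fin.
apply: (@le_trans _ _ (\sum_(j < k) (k%:R^-1)%:E)%E).
  by rewrite sumEFin lee_fin sumr_const card_ord -[leRHS]mulr_natl mulfV// gt_eqF.
apply: lee_sum => j _.
rewrite (ge0_integralZl_EFin mu)//; last first.
  by apply/measurable_EFinP; exact: measurable_indic.
rewrite integral_indic//.
apply: (@le_trans _ _ ((wt j)%:E * (rad j - rad j.+1)%:E)%E).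
  rewrite -EFinM lee_fin (radS j) mulr2n addrK /wt invfM -mulrA mulVf ?mulr1//.
  by rewrite gt_eqF.
apply: lee_wpmul2l; first by rewrite lee_fin.
rewrite setIC; apply: (lipschitz_crossing_measure psil L0).
  by rewrite (radS j) mulr2n ltrDl.
rewrite psi0 psiL.
have [[p1 p2]|[p1 p2]] := ends; [left|right].
  split; first exact: le_trans p1 (rad_le (ltn_ord j)).
  exact: le_trans (rad_le (leq0n j)) p2.
split; first exact: le_trans (rad_le (leq0n j)) p1.
exact: le_trans p2 (rad_le (ltn_ord j)).
Unshelve. all: by end_near. Qed.

End ShellDensity.

(** * Cubic rings *)

Section CubeRing.
Context {R : realType} {n : nat}.
Implicit Types (a v : 'rV[R]_n) (C : set (rVbar R n)).

(** The paths take values in the compactified space, so that infinity can be the centre, as it is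
    for the exterior of a cube. *)
Lemma path_star_connected C c0 : C c0 ->
  (forall x, C x -> exists f : R -> rVbar R n,
    [/\ {within `[0, 1], continuous f}, f 0 = c0, f 1 = x &
        forall t, 0 <= t <= 1 -> C (f t)]) -> connected C.
Proof.
move=> Cc0 H.
have /choice[f hf] : forall x, exists f : R -> rVbar R n, C x ->
    [/\ {within `[0, 1], continuous f}, f 0 = c0, f 1 = x &
        forall t, 0 <= t <= 1 -> C (f t)].
  move=> x; have [Cx|nCx] := pselect (C x); last by exists (fun=> c0).
  by have [f hf] := H x Cx; exists f.
have -> : C = \bigcup_(x in C) (f x @` `[0, 1]).
  apply/seteqP; split=> [x Cx|x [y Cy [t + <-]]].
    exists x => //; exists 1; first by rewrite /= in_itv/= lexx ler01.
    by have [_ _ ->] := hf x Cx.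
  by rewrite /= in_itv/= => t01; have [_ _ _] := hf y Cy; apply.
apply: bigcup_connected.
  exists c0 => x Cx; exists 0; first by rewrite /= in_itv/= lexx ler01.
  by have [_ -> _] := hf x Cx.
move=> x Cx; have [cf _ _ _] := hf x Cx.
by apply: connected_continuous_connected => //; exact: segment_connected.
Qed.

Lemma ray_to_infinity_continuous a v : v != 0 ->
  {within `[0, 1], continuous (fun t : R =>
     (if t == 0 then None else Some (a + t^-1 *: v)) : rVbar R n)}.
Proof.
move=> v0; pose f (t : R) : rVbar R n :=
  if t == 0 then None else Some (a + t^-1 *: v).
rewrite -/f.
apply/subspace_continuousP => t; rewrite /= in_itv/= /from_subspace => /andP[t0 t1].
move: t0; rewrite le_eqVlt => /predU1P[<-|t0].
  have -> : f 0 = None by rewrite /f eqxx.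
  move=> W [U [cU _] UW].
  have := compact_bounded cU; move=> /ex_strict_bound_gt0[B B0 BU].
  have vn : 0 < `|v| by rewrite normr_gt0.
  (* For [u] below this bound, [u^-1 * |v|] exceeds [B + |a|], so the ray has left the compact set
     [U]. *)
  have e0 : 0 < `|v| / (B + `|a|) by rewrite divr_gt0// ltr_wpDr.
  change (\forall u \near within `[0, 1] (nbhs (0 : R)), W (f u)).
  rewrite near_withinE; near=> u => /=; rewrite in_itv/= => /andP[u0 u1].
  apply: UW; rewrite /f; case: eqP => [_|/eqP un0]; first by right.
  left; exists (a + u^-1 *: v) => // Uu.
  have up : 0 < u by rewrite lt_neqAle eq_sym un0.
  have ue : u < `|v| / (B + `|a|).
    by rewrite -[u]ger0_norm//; near: u; exact: nbhs0_lt.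
  have := BU _ Uu; apply/negP; rewrite -leNgt.
  have : u^-1 * `|v| <= `|a + u^-1 *: v| + `|a|.
    have := ler_normD (a + u^-1 *: v) (- a).
    by rewrite addrAC subrr add0r normrN normrZ gtr0_norm ?invr_gt0.
  apply: contraTT; rewrite -!ltNge => h.
  apply: (@lt_le_trans _ _ (B + `|a|)); first by rewrite ltrD2r.
  rewrite mulrC ler_pdivlMr// mulrC -ler_pdivlMr ?ltr_wpDr//.
  exact: ltW.
apply: cvg_within_filter.
have tn0 : t != 0 by rewrite gt_eqF.
have -> : f t = Some (a + t^-1 *: v) by rewrite /f (negbTE tn0).
have cg : {for t, continuous (fun u : R => a + u^-1 *: v)}.
  apply: continuousD; first exact: cst_continuous.
  apply: continuousZ; last exact: cst_continuous.
  exact: inv_continuous.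
have cs : {for t, continuous (fun u : R => Some (a + u^-1 *: v) : rVbar R n)}.
  apply: (continuous_comp cg).
  exact: one_point_compactification_some_continuous.
apply: cvg_trans cs; apply: near_eq_cvg; near=> u.
rewrite /f ifF//; apply/negbTE; near: u.
apply: open_neq => //.
Unshelve. all: by end_near. Qed.

(** The predicate treats [r <= t] and [r < t] together, that is, the outer continuum and the
    complement of the inner one. Excluding 0 keeps [a] out, so that each point is reached from
    infinity along the ray from [a] through it. *)
Lemma outer_connected a (P : R -> Prop) :
  (forall t u, t <= u -> P t -> P u) -> ~ P 0 ->
  connected [set y : rVbar R n | if y is Some x then P `|x - a| else True].
Proof.
move=> Pup P0; apply: (@path_star_connected _ None) => // -[x|] Px; last first.
  exists (fun=> None); split => //.
  by apply: continuous_subspaceT => t; exact: cst_continuous.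
have v0 : x - a != 0 by apply/eqP => xa; apply: P0; rewrite -(normr0 'rV[R]_n) -xa.
have := @ray_to_infinity_continuous a _ v0; set f := fun t : R => _ => cf.
exists f; split; first exact: cf.
- by rewrite /f eqxx.
- by rewrite /f oner_eq0 invr1 scale1r addrC subrK.
move=> t /andP[t0 t1]; rewrite /f; case: eqP => [//|/eqP tn0] /=.
apply: Pup Px; rewrite addrAC subrr add0r normrZ ler_peMl// ger0_norm ?invr_ge0//.
by rewrite invr_ge1 ?unitfE// lt_neqAle eq_sym tn0.
Qed.

Lemma inner_connected a (P : R -> Prop) :
  (forall t u, 0 <= t -> t <= u -> P u -> P t) -> P 0 ->
  connected [set (Some x : rVbar R n) | x in [set x : 'rV[R]_n | P `|x - a|]].
Proof.
move=> Pdn P0; apply: (@path_star_connected _ (Some a)).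
  by exists a => //=; rewrite subrr normr0.
move=> _ [x Px <-]; exists (fun t => Some (a + t *: (x - a))); split.
- apply: continuous_subspaceT => t.
  have cg : {for t, continuous (fun u : R => a + u *: (x - a))}.
    apply: continuousD; first exact: cst_continuous.
    by apply: continuousZ; [exact: cvg_id|exact: cst_continuous].
  apply: (continuous_comp cg).
  exact: one_point_compactification_some_continuous.
- by rewrite scale0r addr0.
- by rewrite scale1r addrC subrK.
move=> t /andP[t0 t1]; exists (a + t *: (x - a)) => //=.
apply: Pdn Px => //; rewrite addrAC subrr add0r normrZ ger0_norm//.
by rewrite ler_piMl.
Qed.

Definition inner_cube a r : set (rVbar R n) :=
  [set (Some x : rVbar R n) | x in [set x : 'rV[R]_n | `|x - a| <= r]].

Definition outer_cube a r : set (rVbar R n) :=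
  [set y : rVbar R n | if y is Some x then r <= `|x - a| else True].

Lemma inner_cube_filled a r : 0 <= r -> filled_continuum (inner_cube a r).
Proof.
move=> r0; split.
- split; first by exists (Some a); exists a => //=; rewrite subrr normr0.
  + apply: (@inner_connected a (fun t => t <= r)) => // t u _.
    exact: le_trans.
  + apply: continuous_compact; last exact: closed_ball_rV_compact.
    apply: continuous_subspaceT => x.
    exact: one_point_compactification_some_continuous.
- move=> /seteqP[_ /(_ None I)] [x _].
  by [].
rewrite (_ : ~` _ =
  [set y : rVbar R n | if y is Some x then r < `|x - a| else True]).
  apply: (@outer_connected a (fun t => r < t)) => [t u tu rt|].
    exact: lt_le_trans tu.
  by apply/negP; rewrite -leNgt.
apply/seteqP; split=> [[x nx|//]|[x /= rx [y /= yr [yx]]|_ [x _]//]].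
  by rewrite /= ltNge; apply/negP => xr; apply: nx; exists x.
by move: rx; rewrite -yx ltNge yr.
Qed.

Lemma outer_cube_filled a r : 0 < r -> filled_continuum (outer_cube a r).
Proof.
move=> r0.
have CE : ~` outer_cube a r =
    [set (Some x : rVbar R n) | x in [set x : 'rV[R]_n | `|x - a| < r]].
  apply/seteqP; split=> [[x /= nx|/= nN]|_ [x /= xr <-]] /=.
  - by exists x => //=; rewrite ltNge; apply/negP.
  - by exfalso; exact: nN.
  - by apply/negP; rewrite -ltNge.
split.
- split; first by exists None.
  + apply: (@outer_connected a (fun t => r <= t)) => [t u tu rt|].
      exact: le_trans tu.
    by apply/negP; rewrite -ltNge.
  + apply: (subclosed_compact _ (@one_point_compactification_compact 'rV[R]_n)) => //.
    rewrite -openC CE; apply: one_point_compactification_open_some.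
    have -> : [set p : 'rV[R]_n | `|p - a| < r] = ball a r.
      by rewrite mx_norm_ball; apply/seteqP; split=> p /=; rewrite /ball_/= distrC.
    exact: ball_open.
- move=> /seteqP[_ /(_ (Some a) I)] /=.
  by rewrite subrr normr0 leNgt r0.
rewrite CE; apply: (@inner_connected a (fun t => t < r)) => // t u _.
exact: le_lt_trans.
Qed.

Lemma cube_ring_disjoint a r1 r2 : r1 < r2 ->
  inner_cube a r1 `&` outer_cube a r2 = set0.
Proof.
move=> r12; rewrite -subset0 => _ [[x /= xr <-] /= rx].
by move: r12; rewrite ltNge (le_trans rx xr).
Qed.

End CubeRing.

Section CubeRingModulus.
Context {R : realType} {n : nat}.

(** As [Some] is an open map, its image of a neighbourhood [W] of a finite point is a neighbourhood,
    and [finite_part] sends it back into [W]. *)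
Lemma finite_part_continuous (D : set R) (f : R -> rVbar R n) :
  {within D, continuous f} -> (forall t, D t -> f t <> None) ->
  {within D, continuous (@finite_part R n \o f)}.
Proof.
move=> cf fN; apply/subspace_continuousP => t Dt.
move/subspace_continuousP : cf => /(_ t Dt) ft W.
rewrite /from_subspace /=; case E : (f t) => [x|]; last by have := fN t Dt.
rewrite /finite_part/= => Wx; have := ft (Some @` W).
rewrite /from_subspace E => /(_ (@one_point_compactification_some_nbhs _ x W Wx)).
change ((\forall u \near within D (nbhs t), (Some @` W) (f u)) ->
  \forall u \near within D (nbhs t), W (odflt 0 (f u))).
by apply: filterS => u [y Wy <-].
Qed.

Lemma cube_ring_modulus_le (a : 'rV[R]_n) (s : R) (k : nat) (r : Ring R n) :
  (0 < n)%N -> (0 < k)%N -> 0 < s ->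
  ring_compl0 r = inner_cube a (s / 2 ^+ k) -> ring_compl1 r = outer_cube a s ->
  (curve_modulus (ring_curves r) <= (k%:R * (4 / k%:R) ^+ n)%:E)%E.
Proof.
move=> n0 k0 s0 C0 C1.
apply: ge_ereal_inf; exists (\int[lebesgue_rV n]_x (shell_density a s k x ^+ n))%E.
  exists (shell_density a s k) => //; split.
  - exact: measurable_shell_density.
  - exact: shell_density_ge0.
  move=> gam [t1 [t2 [t12 domE ends _]]] lr.
  have sub : `[t1, t2] `<=` curve_dom gam by rewrite domE.
  (* The domain is the compact interval [[t1, t2]], so local rectifiability makes the whole curve
     finite and rectifiable, endpoints included; the end in the outer cube is thus not infinity. *)
  have [gN gfin] := lr t1 t2 (ltW t12) sub.
  have t1in : t1 \in `[t1, t2] by rewrite in_itv/= lexx ltW.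
  have t2in : t2 \in `[t1, t2] by rewrite in_itv/= lexx ltW.
  apply: (@le_trans _ _ (path_integral (shell_density a s k)
      (@finite_part R n \o gam) t1 t2)); last first.
    by apply: ereal_sup_ubound; exists (t1, t2) => //; split => //; exact: ltW.
  apply: shell_density_path_integral => //.
    apply: finite_part_continuous; last by move=> t /gN.
    by have := @curve_continuous _ _ gam; rewrite domE.
  rewrite expr0 divr1 /=; rewrite C0 C1 in ends.
  move: ends (gN _ t1in) (gN _ t2in); rewrite /inner_cube /outer_cube /=.
  case: (gam t1) => [x1|//]; case: (gam t2) => [x2|//] /= ends _ _.
  case: ends => [[[y yr [<-]] x2s]|[x1s [y yr [<-]]]]; [by left|by right].
exact: integral_shell_density_le.
Qed.

End CubeRingModulus.

(** * Uniform perfectness from bounded ring moduli *)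

Lemma bounded_modulus_uniformly_perfect (R : realType) (n : nat)
    (E : set (rVbar R n)) (M : R) : (2 <= n)%N -> 0 < M ->
  (forall r : Ring R n, separates r E -> (ring_modulus r <= M%:E)%E) ->
  uniformly_perfect E.
Proof.
move=> n2 M0 HM.
have n0 : (0 < n)%N by exact: leq_trans n2.
have nR : 0 < n%:R :> R by rewrite ltr0n.
have [A A0 SA] := @sphere_area_gt0_fin R n n0.
(* The energy of [k] shells is [4 ^+ n / k%:R ^+ n.-1], at most [4 ^+ n / k%:R] because [2 <= n];
   this [k] makes it smaller than [A / M ^+ n.-1]. *)
pose k := (Num.truncn (M ^+ n.-1 * 4 ^+ n / A)).+1.
have kR : 0 < k%:R :> R by rewrite ltr0n.
have kM : M ^+ n.-1 * 4 ^+ n / A < k%:R by rewrite truncnS_gt.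
(* The factor [n%:R] absorbs the comparison of norms: a Euclidean gap between [c * r] and [r]
   contains a sup-norm gap between [c * r] and [s = r / n%:R], whose ratio [2 ^+ k] leaves room for
   exactly [k] dyadic shells. *)
pose c : R := (2 ^+ k)^-1 / n%:R.
have tk : 0 < 2 ^+ k :> R by rewrite exprn_gt0.
have ck : (2 ^+ k)^-1 <= 2^-1 :> R.
  by rewrite lef_pV2 ?posrE// -[leLHS]expr1 ler_eXn2l// ltr1n.
have c0 : 0 < c by rewrite divr_gt0// invr_gt0.
have c2 : c <= 2^-1.
  rewrite /c ler_pdivrMr// (le_trans ck)// ler_peMr ?invr_ge0//.
  by rewrite ler1n.
exists c; split=> //; first by rewrite (le_lt_trans c2)// invf_lt1// ltr1n.
move=> a r Ea r0 rE; apply: contrapT => nex.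
have dich x : E (Some x) -> enorm (x - a) <= c * r \/ r <= enorm (x - a).
  move=> Ex; have [|h] := leP (enorm (x - a)) (c * r); first by left.
  right; rewrite leNgt; apply/negP => h2; apply: nex; exists x.
  by rewrite h h2.
pose s := r / n%:R.
have s0 : 0 < s by rewrite divr_gt0.
have csE : s / 2 ^+ k = c * r by rewrite /s /c; field; rewrite !gt_eqF.
have sk : s / 2 ^+ k < s.
  by rewrite ltr_pdivrMr// ltr_pMr// exprn_egt1// ltr1n.
have s1 : 0 <= s / 2 ^+ k by rewrite divr_ge0// ltW.
pose Q := MkRing (inner_cube_filled a s1) (outer_cube_filled a s0)
  (cube_ring_disjoint a sk).
have inn x : enorm (x - a) <= c * r -> inner_cube a (s / 2 ^+ k) (Some x).
  move=> xr; exists x => //=; rewrite csE; apply: le_trans xr.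
  exact: norm_le_enorm.
have out x : r <= enorm (x - a) -> outer_cube a s (Some x).
  move=> xr; rewrite /outer_cube/= /s ler_pdivrMr// mulrC.
  exact: le_trans (enorm_le_norm _).
have sep : separates Q E.
  split.
  - rewrite -subset0 => -[x|] [/not_orP[nI nO] Ex]; last exact: nO.
    by have [/inn|/out] := dich x Ex.
  - exists (Some a); split => //; apply: inn.
    by rewrite subrr enorm0 mulr_ge0// ltW.
  have [EN|EN] := pselect (E None); first by exists None.
  (* Otherwise the dichotomy puts all of [E] within [c * r] of [a], and [c <= 2^-1] gives
     [diam E <= r]. *)
  have [x Ex xr] : exists2 x, E (Some x) & r <= enorm (x - a).
    move: rE; rewrite /diam memNset//.
    move=> /ereal_sup_gt[_ [[x y] [/= Ex Ey] <-]]; rewrite lte_fin => rxy.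
    have [xc|] := dich x Ex; last by exists x.
    have [yc|] := dich y Ey; last by exists y.
    exfalso; move: rxy; apply/negP; rewrite -leNgt.
    have -> : x - y = (x - a) + (a - y) by rewrite addrA subrK.
    rewrite (le_trans (ler_enormD _ _))// (enormB a).
    apply: le_trans (lerD xc yc) _.
    have cr : c * r <= 2^-1 * r by rewrite ler_pM2r.
    by move: cr; lra.
  by exists (Some x); split => //; exact: out.
have := HM Q sep; apply/negP; rewrite -ltNge.
have := @cube_ring_modulus_le R n a s k Q n0 isT s0 erefl erefl.
rewrite /ring_modulus SA; set mod := curve_modulus _.
set m := k%:R * (4 / k%:R) ^+ n => modm.
have m0 : 0 < m by rewrite mulr_gt0// exprn_gt0// divr_gt0.
have mod0 : (0 <= mod)%E.
  apply: le_ereal_inf_tmp => _ [rho [_ rho0 _] <-].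
  by apply: integral_ge0 => x _; rewrite expe_ge0.
case: (mod) modm mod0 => [d| |]//; rewrite !lee_fin eqe => dm d0.
case: ifPn => [_|dn0]; first exact: ltry.
have {d0} dp : 0 < d by rewrite lt_neqAle eq_sym dn0.
rewrite inver (negbTE dn0) -EFinM poweR_EFin lte_fin.
have e0 : 0 < n.-1%:R :> R by rewrite ltr0n -ltnS prednK.
have Am : M ^+ n.-1 < A / d.
  apply: (@lt_le_trans _ _ (A / m)); last first.
    by rewrite ler_pM2l// lef_pV2.
  rewrite ltr_pdivlMr//; move: kM; rewrite ltr_pdivrMr// => kM.
  have -> : m = 4 ^+ n * (k%:R / k%:R ^+ n).
    by rewrite /m exprMn exprVn mulrCA.
  have -> : k%:R / k%:R ^+ n = (k%:R ^+ n.-1)^-1 :> R.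
    have kn : k%:R ^+ n = k%:R * k%:R ^+ n.-1 :> R by rewrite -exprS prednK.
    by rewrite kn; field; rewrite !gt_eqF// exprn_gt0.
  rewrite mulrA ltr_pdivrMr ?exprn_gt0//.
  apply: (lt_le_trans kM); rewrite mulrC ler_pM2l//.
  by rewrite ler_eXnr ?ler1n// -ltnS prednK.
rewrite ltNge; apply/negP => h.
move: Am; apply/negP; rewrite -leNgt.
have Ad0 : 0 <= A / d by rewrite divr_ge0// ltW.
rewrite -powR_mulrn; last exact: ltW.
have -> : A / d = ((A / d) `^ (n.-1%:R^-1)) `^ n.-1%:R.
  by rewrite -powRrM mulVf ?gt_eqF// powRr1.
apply: ge0_ler_powR => //; rewrite ?nnegrE ?powR_ge0//; exact: ltW.
Qed.

Theorem theorem3p8 (R : realType) (n : nat) (hn : (2 <= n)%N)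
    (E : set (rVbar R n)) (hE : closed E)
    (hE2 : exists x y : rVbar R n, [/\ E x, E y & x <> y]) :
  uniformly_perfect E <->
  exists M : R, 0 < M /\
    forall r : Ring R n, separates r E -> (ring_modulus r <= M%:E)%E.
Proof.
split; first exact: uniformly_perfect_modulus_bounded.
by move=> [M [M0 HM]]; exact: bounded_modulus_uniformly_perfect HM.
Qed.
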